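(* For semi-density matrices $\sigma,\rho$ on $n$ qubits, $\mathbf{I}(\sigma:\rho)=^{+}\mathbf{I}(\rho:\sigma)$.
   Context: $U$ is a fixed universal prefix Turing machine and $\mathbf{m}(x/y)=\sum_p 2^{-\|p\|}[U_y(p)=x]$ the universal probability. A program $q$ lower computes a positive semidefinite matrix $\sigma$ if $U(q)$ outputs an increasing sequence of elementary (rational-entry) semi-density matrices converging to $\sigma$; $\underline{\mathbf{m}}(\sigma/x)=\sum\{\mathbf{m}(q/x): q\text{ lower computes }\sigma\}$. The universal semi-density matrix on $n$ qubits is $\boldsymbol{\mu}=\sum_{\text{elementary }|\phi\rangle}\mathbf{m}(|\phi\rangle/n)|\phi\rangle\langle\phi|$. Let $\mathcal{C}_{C\otimes D}$ be the set of lower computable matrices of the form $A\otimes B$ with $\mathrm{Tr}(A\otimes B)(C\otimes D)\le1$, and $\mathfrak{C}_{C\otimes D}=\sum_{A\otimes B\in\mathcal{C}_{C\otimes D}}\underline{\mathbf{m}}(A\otimes B/n)A\otimes B$. The mutual information is $\mathbf{I}(\sigma:\rho)=\log\mathrm{Tr}\,\mathfrak{C}_{\boldsymbol{\mu}\otimes\boldsymbol{\mu}}(\sigma\otimes\rho)$. $=^{+}$ denotes equality up to an additive $O(1)$. *)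

(* Defs.v *)
From Stdlib Require Import BinNums BinNat.
From HB Require Import structures.
From mathcomp Require Import all_boot all_order all_algebra.
From mathcomp Require Import spectral.
From mathcomp.real_closed Require Import complex mxtens.
From mathcomp Require Import all_classical all_reals all_analysis.

Set Implicit Arguments.
Unset Strict Implicit.
Unset Printing Implicit Defensive.

Import Order.TTheory GRing.Theory Num.Theory.
Import numFieldNormedType.Exports.

Local Open Scope classical_set_scope.
Local Open Scope sesquilinear_scope.
Local Open Scope ring_scope.

(* Two-way infinite tapes; [None] is the blank, and the cells beyond the two
   lists are blank. [tleft] lists the cells left of the head, nearest first. *)
Record tape (A : Type) := Tape {
  tleft : seq (option A); thead : option A; tright : seq (option A) }.

Variant move := MoveL | Stay | MoveR.

Definition tape_of (A : Type) (s : seq A) : tape A :=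
  Tape [::] (ohead s) (behead (map Some s)).

Definition tape_write (A : Type) (a : option A) (t : tape A) : tape A :=
  Tape (tleft t) a (tright t).

Definition tape_move (A : Type) (m : move) (t : tape A) : tape A :=
  match m with
  | MoveL => Tape (behead (tleft t)) (head None (tleft t)) (thead t :: tright t)
  | Stay => t
  | MoveR => Tape (thead t :: tleft t) (head None (tright t)) (behead (tright t))
  end.

(* [Read] consumes the next bit of the one-way input tape, [Write] appends a
   bit to the one-way output tape, and [Work] moves the head of the read-only
   auxiliary tape and writes and moves on every work tape. *)
Variant instr (S K G : Type) :=
  | Halt
  | Read of (bool -> S)
  | Write of bool & S
  | Work of S & move & (K -> option G * move).
Arguments Halt {S K G}.

Record machine := Machine {
  state : finType;
  wtape : finType;
  symb : finType;
  start : state;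
  delta : state -> option bool -> {ffun wtape -> option symb} ->
          instr state wtape symb }.

Record config (M : machine) := Config {
  cstate : state M;
  cinput : seq bool;
  caux : tape bool;
  cwork : wtape M -> tape (symb M);
  coutput : seq bool }.

Definition cinstr (M : machine) (c : config M) :=
  delta (cstate c) (thead (caux c)) [ffun k => thead (cwork c k)].

(* A machine that tries to read past the end of its input is blocked forever. *)
Definition step (M : machine) (c : config M) : config M :=
  match cinstr c with
  | Halt => c
  | Read f => if cinput c is b :: p
              then Config (f b) p (caux c) (cwork c) (coutput c) else c
  | Write b s =>
      Config s (cinput c) (caux c) (cwork c) (rcons (coutput c) b)
  | Work s m a =>
      Config s (cinput c) (tape_move m (caux c))
        (fun k => tape_move (a k).2 (tape_write (a k).1 (cwork c k)))
        (coutput c)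
  end.

Definition init (M : machine) (y p : seq bool) : config M :=
  Config (start M) p (tape_of y) (fun=> tape_of [::]) [::].

Definition run (M : machine) (y p : seq bool) (k : nat) : config M :=
  iter k (@step M) (init M y p).

Definition halted (M : machine) (c : config M) : bool :=
  if cinstr c is Halt then true else false.

(* M_y(p) = x: the machine halts having read exactly the bits of p, so that
   the domain of p |-> M_y(p) is prefix-free. *)
Definition computes (M : machine) (y p x : seq bool) : Prop :=
  exists k, let c := run M y p k in
    [/\ halted c, cinput c = [::] & coutput c = x].

(* w is an initial segment of the (finite or infinite) output of M_y(p),
   whether or not the machine halts. *)
Definition emits (M : machine) (y p w : seq bool) : Prop :=
  exists k, prefix w (coutput (run M y p k)).

Definition universal (U : machine) : Prop :=
  forall T : machine, exists t : seq bool, forall y p : seq bool,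
    (forall x, computes T y p x <-> computes U y (t ++ p) x) /\
    (forall w, emits T y p w <-> emits U y (t ++ p) w).

Fixpoint pos_bits (p : positive) : seq bool :=
  match p with
  | xH => [:: true]
  | xO p => rcons (pos_bits p) false
  | xI p => rcons (pos_bits p) true
  end.

Definition nat_bits (n : nat) : seq bool :=
  if N.of_nat n is Npos p then pos_bits p else [::].

Definition bits_nat (s : seq bool) : nat := foldl (fun a (b : bool) => a.*2 + b)%N 0%N s.

(* 1 s_1 1 s_2 ... 1 s_k 0 *)
Definition selfdelim (s : seq bool) : seq bool :=
  flatten [seq [:: true; b] | b <- s] ++ [:: false].

Definition rat_code (a : rat) : seq bool :=
  (numq a < 0) :: selfdelim (nat_bits `|numq a|%N)
               ++ selfdelim (nat_bits `|denq a|%N).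

Definition crat_code (z : complex rat) : seq bool :=
  rat_code (complex.Re z) ++ rat_code (complex.Im z).

Definition vec_code (d : nat) (phi : 'cV[complex rat]_d) : seq bool :=
  flatten [seq crat_code (phi i 0) | i <- enum 'I_d].

(* An elementary matrix on N qubits is output as a list of terms (r, s, z),
   with r and s bit strings of length N, standing for the sum of the matrices
   z |r><s|. *)
Definition term := (seq bool * seq bool * complex rat)%type.

Definition term_code (t : term) : seq bool :=
  true :: selfdelim t.1.1 ++ selfdelim t.1.2 ++ crat_code t.2.

Definition mx_code (l : seq term) : seq bool :=
  flatten (map term_code l) ++ [:: false].

Definition terms_on (N : nat) (l : seq term) : bool :=
  all (fun t : term => (size t.1.1 == N) && (size t.1.2 == N)) l.

Definition crat (R : realType) (z : complex rat) : R[i] :=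
  Complex (ratr (complex.Re z)) (ratr (complex.Im z)).

Definition terms_mx (R : realType) (N : nat) (l : seq term) : 'M[R[i]]_(2 ^ N) :=
  \matrix_(i, j) \sum_(t <- l | (bits_nat t.1.1 == i) && (bits_nat t.1.2 == j))
                   crat R t.2.

(* In the order of R[i], 0 <= z means that z is real and nonnegative; hence
   such an A is Hermitian. *)
Definition psd (R : realType) (d : nat) (A : 'M[R[i]]_d) : Prop :=
  forall v : 'cV[R[i]]_d, 0 <= (v ^t* *m A *m v) 0 0.

Definition semi_density (R : realType) (d : nat) (A : 'M[R[i]]_d) : Prop :=
  psd A /\ \tr A <= 1.

Definition loewner_le (R : realType) (d : nat) (A B : 'M[R[i]]_d) : Prop :=
  psd (B - A).

Definition mx_cvg (R : realType) (d : nat) (E : nat -> 'M[R[i]]_d)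
    (A : 'M[R[i]]_d) : Prop :=
  forall i j, ((fun k => complex.Re (E k i j)) @ \oo --> complex.Re (A i j)) /\
              ((fun k => complex.Im (E k i j)) @ \oo --> complex.Im (A i j)).

Definition qtens (R : realType) (n : nat) (A B : 'M[R[i]]_(2 ^ n)) :
    'M[R[i]]_(2 ^ (n + n)) :=
  castmx (esym (expnD 2 n n), esym (expnD 2 n n)) (A *t B).

(* Meaningful for absolutely summable families only; this covers every use
   below, the weights having sum at most 1. *)
Definition rsum (R : realType) (T : choiceType) (D : set T) (f : T -> R) : R :=
  fine (\esum_(x in D) (f^\+ x)%:E) - fine (\esum_(x in D) (f^\- x)%:E).

Definition mxsum (R : realType) (T : choiceType) (D : set T) (d : nat)
    (F : T -> 'M[R[i]]_d) : 'M[R[i]]_d :=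
  \matrix_(i, j) Complex (rsum D (fun x => complex.Re (F x i j)))
                         (rsum D (fun x => complex.Im (F x i j))).

(* m(x/y) *)
Definition uprob (R : realType) (U : machine) (x y : seq bool) : \bar R :=
  \esum_(p in [set p | computes U y p x]) ((2^-1 : R) ^+ size p)%:E.

Definition lower_computes (R : realType) (U : machine) (N : nat) (q : seq bool)
    (sigma : 'M[R[i]]_(2 ^ N)) : Prop :=
  psd sigma /\
  exists L : nat -> seq term,
    let E k := terms_mx R N (L k) in
    [/\ forall k, terms_on N (L k) /\ semi_density (E k),
        forall k, loewner_le (E k) (E k.+1),
        mx_cvg E sigma &
        forall k, emits U [::] q (flatten [seq mx_code (L i) | i <- iota 0 k])].

Definition lower_computable (R : realType) (U : machine) (N : nat)
    (sigma : 'M[R[i]]_(2 ^ N)) : Prop :=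
  exists q, lower_computes U q sigma.

(* m(sigma/x), with m underlined *)
Definition lprob (R : realType) (U : machine) (N : nat)
    (sigma : 'M[R[i]]_(2 ^ N)) (x : seq bool) : \bar R :=
  \esum_(q in [set q | lower_computes U q sigma]) uprob R U q x.

Definition ket (R : realType) (d : nat) (phi : 'cV[complex rat]_d) :
    'cV[R[i]]_d := map_mx (crat R) phi.

Definition elementary_states (R : realType) (n : nat) :
    set 'cV[complex rat]_(2 ^ n) :=
  [set phi | (ket R phi) ^t* *m ket R phi = 1%:M].
Arguments elementary_states : clear implicits.

(* The matrix mu. *)
Definition usdm (R : realType) (U : machine) (n : nat) : 'M[R[i]]_(2 ^ n) :=
  mxsum (elementary_states R n) (fun phi =>
    Complex (fine (uprob R U (vec_code phi) (nat_bits n))) 0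
      *: (ket R phi *m (ket R phi) ^t*)).

(* The set written C_{C (x) D}. *)
Definition tests (R : realType) (U : machine) (n : nat)
    (C D : 'M[R[i]]_(2 ^ n)) : set 'M[R[i]]_(2 ^ (n + n)) :=
  [set X | lower_computable U X /\
           exists A B : 'M[R[i]]_(2 ^ n),
             X = qtens A B /\ \tr (qtens A B *m qtens C D) <= 1].

(* The universal test, written as a Fraktur C indexed by C (x) D. *)
Definition universal_test (R : realType) (U : machine) (n : nat)
    (C D : 'M[R[i]]_(2 ^ n)) : 'M[R[i]]_(2 ^ (n + n)) :=
  mxsum (tests U C D) (fun X => Complex (fine (lprob U X (nat_bits n))) 0 *: X).

Definition log2e (R : realType) (x : \bar R) : \bar R :=
  (lne x * ((ln 2)^-1)%:E)%E.

(* The trace is that of a product of two positive semidefinite matrices, hence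
   real; the information is -oo when it is 0. *)
Definition mutual_info (R : realType) (U : machine) (n : nat)
    (sigma rho : 'M[R[i]]_(2 ^ n)) : \bar R :=
  log2e (complex.Re (\tr (universal_test U (usdm R U n) (usdm R U n)
                    *m qtens sigma rho)))%:E.

(* Main.v *)
From Pilot Require Import Defs.
From HB Require Import structures.
From Stdlib Require Import NArith.
From mathcomp Require Import all_boot all_order all_algebra.
From mathcomp Require Import spectral ring lra zify.
From mathcomp.real_closed Require Import complex mxtens.
From mathcomp Require Import all_classical all_reals all_analysis.
(* [thead] is the head cell of a tape, not the first component of a tuple. *)
Import Pilot.Defs.

(* Exchanging the two tensor factors sends A (x) B to B (x) A and preserves
   traces of products, hence permutes the tests for mu (x) mu and turns
   Tr X (sigma (x) rho) into Tr X' (rho (x) sigma). On programs it is computed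
   by a machine that runs U and swaps the two halves of every index string in
   the output; by universality it acts on programs as q |-> t q for a fixed
   prefix t. A second machine prints t before simulating U, so that
   m(q/n) <= 2^|u| m(t q/n) for a fixed word u, and the weights of X and X'
   differ by at most that factor. Summing over all tests gives the inequality
   with constant |u|; the other one is obtained by exchanging the roles of
   sigma and rho. The sums are finite by Kraft's inequality, since a program
   lower computes at most one matrix, and their terms are nonnegative, since
   sigma (x) rho = W W^* for some W. *)

Set Implicit Arguments.
Unset Strict Implicit.
Unset Printing Implicit Defensive.

(** * Relabelling the symbols of a tape *)

Definition tape_map (A B : Type) (f : A -> B) (t : tape A) : tape B :=
  Tape (map (omap f) (tleft t)) (omap f (thead t)) (map (omap f) (tright t)).

Lemma tape_map_move (A B : Type) (f : A -> B) m (t : tape A) :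
  tape_map f (tape_move m t) = tape_move m (tape_map f t).
Proof. by case: m t => -[[|x l] h [|y r]]. Qed.

Lemma tape_map_write (A B : Type) (f : A -> B) a (t : tape A) :
  tape_map f (tape_write a t) = tape_write (omap f a) (tape_map f t).
Proof. by []. Qed.

Lemma tape_write_head (A : Type) (t : tape A) : tape_write (thead t) t = t.
Proof. by case: t. Qed.

(** * Printing a fixed word first *)

Definition instr_map (S S' K G : Type) (f : S -> S') (i : instr S K G) :
    instr S' K G :=
  match i with
  | Halt => Halt
  | Read g => Read _ _ (fun b => f (g b))
  | Write b s => Write _ _ b (f s)
  | Work s m a => Work (f s) m a
  end.

Definition print_bit (b : bool) (M : machine) : machine :=
  @Machine (option (state M)) (wtape M) (symb M) None
    (fun s x h => if s is Some s then instr_map Some (delta s x h)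
                  else Write _ _ b (Some (start M))).

Section PrintBit.
Variables (b : bool) (M : machine).

Definition printed (c : config M) : config (print_bit b M) :=
  @Config (print_bit b M) (Some (cstate c)) (cinput c) (caux c) (cwork c)
    (b :: coutput c).

Lemma cinstr_printed c : cinstr (printed c) = instr_map Some (cinstr c).
Proof. by []. Qed.

Lemma step_printed c : step (printed c) = printed (step c).
Proof.
rewrite /step cinstr_printed; case: (cinstr c) => //= f.
by case: (cinput c).
Qed.

Lemma computes_print_bit y p x :
  computes M y p x -> computes (print_bit b M) y p (b :: x).
Proof.
case=> k /= [hk ik ok]; exists k.+1.
have -> : run (print_bit b M) y p k.+1 = printed (run M y p k).
  rewrite /run iterSr.
  have -> : step (init (print_bit b M) y p) = printed (init M y p) by [].
  by elim: k {hk ik ok} => //= k ->; rewrite step_printed.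
split=> //=; last by rewrite ok.
by move: hk; rewrite /halted cinstr_printed; case: (cinstr _).
Qed.

End PrintBit.

Lemma print_word (M : machine) (t : seq bool) :
  exists T : machine, forall y p x,
    computes M y p x -> computes T y p (t ++ x).
Proof.
elim: t => [|b t [T hT]]; first by exists M.
by exists (print_bit b T) => y p x /hT; apply: computes_print_bit.
Qed.

(** * Online post-processing of the output of a machine *)

Variant action (S : Type) :=
  | Emit of bool & S
  | Act of S & option bool * move & option bool * move.

Record oconfig (S : Type) := OConfig {
  ostate : S; otape1 : tape bool; otape2 : tape bool; oout : seq bool }.

Definition perform (S : Type) (a : action S) (o : oconfig S) : oconfig S :=
  match a with
  | Emit b s => OConfig s (otape1 o) (otape2 o) (rcons (oout o) b)
  | Act s a1 a2 =>
      OConfig s (tape_move a1.2 (tape_write a1.1 (otape1 o)))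
        (tape_move a2.2 (tape_write a2.1 (otape2 o))) (oout o)
  end.

Section Postprocess.
Variables (S : finType) (s0 : S).
(* [work s h1 h2] is the action in state s when the two private tapes show h1
   and h2, or [None] if the next output bit of M is awaited; [feed s b] is the
   action triggered by that bit. *)
Variables (work : S -> option bool -> option bool -> option (action S))
          (feed : S -> bool -> action S).
Variable M : machine.

(** A [Work] instruction writes on every work tape, so a tape of [M] is left alone by rewriting its
    scanned symbol, supplied by [h], without moving. *)
Definition lift_action (h : {ffun wtape M + bool -> option (symb M + bool)})
    (s : state M) (a : action S) :
    instr (state M * S) (wtape M + bool) (symb M + bool) :=
  match a with
  | Emit b t => Write _ _ b (s, t)
  | Act t a1 a2 => Work (s, t) Stay (fun k =>
      match k with
      | inl k => (h (inl k), Stay)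
      | inr true => (omap inr a1.1, a1.2)
      | inr false => (omap inr a2.1, a2.2)
      end)
  end.

Definition lproj (A B : Type) (u : A + B) : option A :=
  if u is inl a then Some a else None.
Definition rproj (A B : Type) (u : A + B) : option B :=
  if u is inr b then Some b else None.

(** Private work takes precedence over the simulated machine. All tapes share one alphabet; [lproj]
    and [rproj] discard symbols of the wrong kind, which never occur in configurations of the form
    [joint c o]. *)
Definition postprocess : machine :=
  @Machine (state M * S)%type (wtape M + bool)%type (symb M + bool)%type
    (start M, s0)
    (fun s x h =>
       if work s.2 (obind (@rproj _ _) (h (inr true)))
            (obind (@rproj _ _) (h (inr false))) is Some a
       then lift_action h s.1 a
       else match delta s.1 x [ffun k => obind (@lproj _ _) (h (inl k))] with
            | Halt => Halt
            | Read f => Read _ _ (fun b => (f b, s.2))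
            | Write b t => lift_action h t (feed s.2 b)
            | Work t m a => Work (t, s.2) m (fun k =>
                match k with
                | inl k => (omap inl (a k).1, (a k).2)
                | inr b => (h (inr b), Stay)
                end)
            end).

Definition joint (c : config M) (o : oconfig S) : config postprocess :=
  @Config postprocess (cstate c, ostate o) (cinput c) (caux c)
    (fun k => match k with
              | inl k => tape_map inl (cwork c k)
              | inr true => tape_map inr (otape1 o)
              | inr false => tape_map inr (otape2 o)
              end) (oout o).

Definition joint_heads c o := [ffun k => thead (cwork (joint c o) k)].

Lemma joint_cinstr c o :
  cinstr (joint c o) =
  if work (ostate o) (thead (otape1 o)) (thead (otape2 o)) is Some a
  then lift_action (joint_heads c o) (cstate c) a
  else match cinstr c with
       | Halt => Halt
       | Read f => Read _ _ (fun b => (f b, ostate o))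
       | Write b t => lift_action (joint_heads c o) t (feed (ostate o) b)
       | Work t m a => Work (t, ostate o) m (fun k =>
                match k with
                | inl k => (omap inl (a k).1, (a k).2)
                | inr b => (joint_heads c o (inr b), Stay)
                end)
       end.
Proof.
rewrite {1}/cinstr /= -/(joint_heads c o).
set h := joint_heads c o.
have hr (x : option bool) : obind (@rproj (symb M) bool) (omap inr x) = x.
  by case: x.
have -> : [ffun k => obind (@lproj (symb M) bool) (h (inl k))] =
          [ffun k => thead (cwork c k)].
  by apply/ffunP => k; rewrite !ffunE /=; case: (thead _).
by rewrite !ffunE /= !hr.
Qed.

(** Serves both private work, with [c' = c], and the consumption of an output bit, with
    [c' = step c]: [joint] keeps no record of the output of its first argument. *)
Lemma step_lift (c c' : config M) (a : action S) o :
    cinstr (joint c o) =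
      lift_action (joint_heads c o) (cstate c') a ->
    cinput c' = cinput c -> caux c' = caux c -> cwork c' = cwork c ->
  step (joint c o) = joint c' (perform a o).
Proof.
rewrite /step /joint => -> -> -> ->; case: a => [b t|t a1 a2] //=.
congr Config; apply/funext => -[k|[]].
- by rewrite /= ffunE tape_write_head.
- by rewrite tape_map_move tape_map_write.
- by rewrite tape_map_move tape_map_write.
Qed.

Definition ostep (o : oconfig S) : oconfig S :=
  if work (ostate o) (thead (otape1 o)) (thead (otape2 o)) is Some a
  then perform a o else o.

Lemma step_work c o a :
  work (ostate o) (thead (otape1 o)) (thead (otape2 o)) = Some a ->
  step (joint c o) = joint c (ostep o).
Proof.
move=> ha; rewrite /ostep ha; apply: step_lift => //.
by rewrite joint_cinstr ha.
Qed.

(** The number of steps is uniform in [c], as private work neither depends on the configuration of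
    [M] nor changes it. *)
Definition reach (o o' : oconfig S) : Prop :=
  exists m, forall c, iter m (@step postprocess) (joint c o) = joint c o'.

Lemma reach_refl o : reach o o.
Proof. by exists 0. Qed.

Lemma reach_trans o2 o1 o3 : reach o1 o2 -> reach o2 o3 -> reach o1 o3.
Proof.
by move=> [m hm] [k hk]; exists (k + m) => c; rewrite iterD hm hk.
Qed.

Lemma reach_step o a o' :
  work (ostate o) (thead (otape1 o)) (thead (otape2 o)) = Some a ->
  reach (perform a o) o' -> reach o o'.
Proof.
move=> ha; apply: reach_trans; exists 1 => c /=.
by rewrite (step_work _ ha) /ostep ha.
Qed.

Lemma step_wait c o :
    work (ostate o) (thead (otape1 o)) (thead (otape2 o)) = None ->
  step (joint c o) = joint (step c)
    (if cinstr c is Write b _ then perform (feed (ostate o) b) o else o).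
Proof.
move=> ho; have := joint_cinstr c o; rewrite ho.
rewrite [step c]/step; case E: (cinstr c) => [|f|b t|t m a] H.
- by rewrite /step H.
- by rewrite /step H [cinput (joint c o)]/=; case: (cinput c).
- exact: step_lift.
rewrite /step H /joint /=; congr Config; apply/funext => -[k|[]].
- by rewrite /= tape_map_move tape_map_write.
- by rewrite ffunE; apply: tape_write_head.
- by rewrite ffunE; apply: tape_write_head.
Qed.

(* [good w o]: o is a waiting configuration reached after processing the
   word w. *)
Lemma postprocess_run (good : seq bool -> oconfig S -> Prop) :
    good [::] (OConfig s0 (tape_of [::]) (tape_of [::]) [::]) ->
    (forall w o, good w o ->
       work (ostate o) (thead (otape1 o)) (thead (otape2 o)) = None) ->
    (forall w o b, good w o ->
       exists2 o', good (rcons w b) o' &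
                   reach (perform (feed (ostate o) b) o) o') ->
  forall y p k, exists m o, good (coutput (run M y p k)) o /\
    run postprocess y p m = joint (run M y p k) o.
Proof.
move=> h0 hw hf y p; elim=> [|k [m [ o [ho hm]]]].
  exists 0, (OConfig s0 (tape_of [::]) (tape_of [::]) [::]); split=> //.
  by rewrite /run /init /joint /=; congr Config; apply/funext => -[k|[]].
have hs := step_wait (run M y p k) (hw _ _ ho).
have hS : run postprocess y p m.+1 = step (joint (run M y p k) o).
  by rewrite /run iterS -/(run _ _ _ _) hm.
have hk : run M y p k.+1 = step (run M y p k) by [].
rewrite hk; move: hs; set c := run M y p k in hm ho hS *.
case E: (cinstr c) => [|f|b t|t mv a] hs.
- by exists m.+1, o; rewrite hS hs; split=> //; rewrite /step E.
- exists m.+1, o; rewrite hS hs; split=> //; rewrite /step E.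
  by case: (cinput c).
(* One step hands over the written bit, and [j] more lead to the next waiting configuration. *)
- have [ o' ho' [j hj]] := hf _ _ b ho; exists (j + m.+1), o'; split.
    by rewrite /step E.
  by rewrite /run iterD -/(run _ _ _ _) hS hs hj.
by exists m.+1, o; rewrite hS hs; split=> //; rewrite /step E.
Qed.

End Postprocess.
(** * Swapping the halves of the index strings *)

Variant swapper :=
  | Flag
  | RotFlag of bool & bool
  | RotBit of bool & bool
  | Sign of bool
  | Num of bool & bool & bool
  | Rewind of bool
  | Out2 of bool | Out2bit of bool | Out2next of bool
  | Back of bool
  | Out1 of bool | Out1bit of bool | Out1next of bool
  | Skip of bool
  | Close of bool.

(** Padding the parameters to three bits embeds the states in a finite type, from which [swapper]
    inherits its [finType] structure. *)
Definition swapper_code (s : swapper) : 'I_15 * bool * bool * bool :=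
  let c k a b d := (inord k, a, b, d) in
  let f := false in
  match s with
  | Flag => c 0 f f f
  | RotFlag j q => c 1 j q f
  | RotBit j q => c 2 j q f
  | Sign k => c 3 k f f
  | Num k d e => c 4 k d e
  | Rewind j => c 5 j f f
  | Out2 j => c 6 j f f
  | Out2bit j => c 7 j f f
  | Out2next j => c 8 j f f
  | Back j => c 9 j f f
  | Out1 j => c 10 j f f
  | Out1bit j => c 11 j f f
  | Out1next j => c 12 j f f
  | Skip j => c 13 j f f
  | Close j => c 14 j f f
  end.

Definition swapper_decode (u : 'I_15 * bool * bool * bool) : swapper :=
  let: (i, a, b, d) := u in
  match val i with
  | 0 => Flag
  | 1 => RotFlag a b
  | 2 => RotBit a b
  | 3 => Sign a
  | 4 => Num a b d
  | 5 => Rewind a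
  | 6 => Out2 a
  | 7 => Out2bit a
  | 8 => Out2next a
  | 9 => Back a
  | 10 => Out1 a
  | 11 => Out1bit a
  | 12 => Out1next a
  | 13 => Skip a
  | _ => Close a
  end.

Lemma swapper_codeK : cancel swapper_code swapper_decode.
Proof. by case=> *; rewrite /swapper_decode /= inordK. Qed.

HB.instance Definition _ := Finite.copy swapper (can_type swapper_codeK).

(* The states [Flag], [RotFlag j q], [RotBit j q], [Sign k] and [Num k d e]
   parse a sequence of matrix codes: j tells which of the two index strings is
   being read and q is the parity of the number of its bits seen so far; k
   distinguishes real and imaginary part, d numerator and denominator, and e
   tells whether a data bit is expected. *)
Definition swap_feed (s : swapper) (b : bool) : action swapper :=
  match s with
  | Flag => Emit b (if b then RotFlag false false else Flag)
  | RotFlag j q =>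
      if b then Act (RotBit j q) (None, Stay) (None, Stay)
      else Act (Rewind j) (None, Stay) (None, MoveL)
  | RotBit j q =>
      Act (RotFlag j (~~ q)) (Some b, MoveR)
          (if q then (Some true, MoveR) else (None, Stay))
  | Sign k => Emit b (Num k false false)
  | Num k d true => Emit b (Num k d false)
  | Num k d false =>
      Emit b (if b then Num k d true else
              if d then (if k then Flag else Sign true) else Num k true false)
  | _ => Emit b s
  end.

(* The first tape holds the index string, the second one a unary counter of
   half its length. [Rewind] moves the first head back to the middle, [Out2]
   prints the second half, [Back] returns to the beginning, [Out1] prints the
   first half, [Skip] and [Close] move both heads to a blank region. *)
Definition swap_work (s : swapper) (h1 h2 : option bool) :
    option (action swapper) :=
  match s with
  | Rewind j => Some (if h2 then Act (Rewind j) (h1, MoveL) (h2, MoveL)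
                      else Act (Out2 j) (h1, Stay) (h2, MoveR))
  | Out2 j => Some (if h1 then Emit true (Out2bit j)
                    else Act (Back j) (h1, MoveL) (h2, Stay))
  | Out2bit j => Some (Emit (h1 == Some true) (Out2next j))
  | Out2next j => Some (Act (Out2 j) (h1, MoveR) (h2, Stay))
  | Back j => Some (if h1 then Act (Back j) (h1, MoveL) (h2, Stay)
                    else Act (Out1 j) (h1, MoveR) (h2, Stay))
  | Out1 j => Some (if h2 then Emit true (Out1bit j)
                    else Act (Skip j) (h1, Stay) (h2, Stay))
  | Out1bit j => Some (Emit (h1 == Some true) (Out1next j))
  | Out1next j => Some (Act (Out1 j) (h1, MoveR) (h2, MoveR))
  | Skip j => Some (if h1 then Act (Skip j) (h1, MoveR) (h2, Stay)
                    else Emit false (Close j))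
  | Close j => Some (Act (if j then Sign false else RotFlag true false)
                         (None, MoveR) (None, MoveR))
  | _ => None
  end.

(** * Tapes holding a word, and runs of the private work *)

Definition zipper (l : seq (option bool)) (xs ys : seq bool) : tape bool :=
  Tape (rev (map Some xs) ++ l) (ohead ys)
    (behead (rcons (map Some ys) None)).

(** The trailing [None] in [zipper] is the cell that a head leaves behind when it returns from the
    blank after the word; with it, moves are exact equalities of tapes. *)
Lemma zipperR l xs y ys :
  tape_move MoveR (zipper l xs (y :: ys)) = zipper l (rcons xs y) ys.
Proof. by rewrite /zipper map_rcons rev_rcons; case: ys. Qed.

Lemma zipperL l xs y ys :
  tape_move MoveL (zipper l (rcons xs y) ys) = zipper l xs (y :: ys).
Proof. by rewrite /zipper map_rcons rev_rcons; case: ys. Qed.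

(** A visit to the left of the word turns an empty [l] into [[:: None]], so [l] is not restored
    literally; this is why later statements ask for [head None l = None] only. *)
Lemma zipperLR l ys :
  tape_move MoveR (tape_move MoveL (zipper l [::] ys)) =
  zipper (head None l :: behead l) [::] ys.
Proof. by case: ys. Qed.

Definition sd_bits (s : seq bool) : seq bool :=
  flatten [seq [:: true; b] | b <- s].

(* If [size s] is odd, the middle bit is lost. *)
Definition swap_halves (s : seq bool) : seq bool :=
  drop (size s - (size s)./2) s ++ take (size s)./2 s.

Lemma perform_Act (S : Type) (s s' : S) a1 m1 a2 m2 t1 t2 out :
  perform (Act s' (a1, m1) (a2, m2)) (OConfig s t1 t2 out) =
  OConfig s' (tape_move m1 (tape_write a1 t1)) (tape_move m2 (tape_write a2 t2))
    out.
Proof. by []. Qed.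

Section SwapRun.
Variable M : machine.
Local Notation reach := (@reach _ Flag swap_work swap_feed M).

Lemma reach_work s t1 t2 out a o' :
  swap_work s (thead t1) (thead t2) = Some a ->
  reach (perform a (OConfig s t1 t2 out)) o' ->
  reach (OConfig s t1 t2 out) o'.
Proof. by move=> h; apply: reach_step. Qed.

(** The second tape carries one mark per bit of [x2], so the two heads moving left together bring
    the first one exactly to the start of [x2]. *)
Lemma reach_rewind j l l' x1 x2 ys zs out : head None l' = None ->
  reach (OConfig (Rewind j) (zipper l (x1 ++ x2) ys)
           (tape_move MoveL (zipper l' (nseq (size x2) true) zs)) out)
        (OConfig (Out2 j) (zipper l x1 (x2 ++ ys))
           (zipper (None :: behead l') [::] (nseq (size x2) true ++ zs)) out).
Proof.
move=> hl; elim/last_ind: x2 ys zs => [|x2 x IH] ys zs.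
  rewrite cats0; apply: reach_work; first by rewrite /= hl.
  (* The [None] being written is the blank already scanned, so the write changes nothing. *)
  rewrite perform_Act -[X in tape_move MoveR (tape_write X _)]hl.
  have -> : head None l' = thead (tape_move MoveL (zipper l' [::] zs)) by [].
  by rewrite !tape_write_head zipperLR hl; apply: reach_refl.
have -> : nseq (size (rcons x2 x)) true = rcons (nseq (size x2) true) true.
  by rewrite size_rcons -addn1 nseqD cats1.
rewrite zipperL -rcons_cat !cat_rcons.
apply: reach_work; first by [].
rewrite perform_Act !tape_write_head zipperL.
exact: IH.
Qed.

Lemma reach_out2 j l xs ys t out :
  reach (OConfig (Out2 j) (zipper l xs ys) t out)
        (OConfig (Back j) (tape_move MoveL (zipper l (xs ++ ys) [::])) t
           (out ++ sd_bits ys)).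
Proof.
elim: ys xs out => [|y ys IH] xs out.
  apply: reach_work; first by [].
  by rewrite perform_Act !cats0 !tape_write_head; apply: reach_refl.
apply: reach_work; first by [].
apply: reach_work; first by [].
apply: reach_work; first by [].
rewrite perform_Act !tape_write_head zipperR -cat_rcons.
have -> : out ++ sd_bits (y :: ys) = rcons (rcons out true) y ++ sd_bits ys.
  by rewrite !cat_rcons.
by case: y; apply: IH.
Qed.

Lemma reach_back j l xs ys t out : head None l = None ->
  reach (OConfig (Back j) (tape_move MoveL (zipper l xs ys)) t out)
        (OConfig (Out1 j) (zipper (None :: behead l) [::] (xs ++ ys)) t out).
Proof.
move=> hl; elim/last_ind: xs ys => [|xs x IH] ys.
  apply: reach_work; first by rewrite /= hl.
  rewrite perform_Act -[X in tape_move MoveR (tape_write X _)]hl.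
  have -> : head None l = thead (tape_move MoveL (zipper l [::] ys)) by [].
  by rewrite !tape_write_head zipperLR hl; apply: reach_refl.
rewrite zipperL cat_rcons; apply: reach_work; first by [].
by rewrite perform_Act !tape_write_head; apply: IH.
Qed.

(** Both heads advance together, and the end of the marks stops the printing after as many bits as
    the counter holds. *)
Lemma reach_out1 j l l' xs zs ys1 ys2 out :
  reach (OConfig (Out1 j) (zipper l xs (ys1 ++ ys2))
           (zipper l' zs (nseq (size ys1) true)) out)
        (OConfig (Skip j) (zipper l (xs ++ ys1) ys2)
           (zipper l' (zs ++ nseq (size ys1) true) [::]) (out ++ sd_bits ys1)).
Proof.
elim: ys1 xs zs out => [|y ys IH] xs zs out.
  apply: reach_work; first by [].
  by rewrite perform_Act !cats0 !tape_write_head; apply: reach_refl.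
apply: reach_work; first by [].
apply: reach_work; first by [].
apply: reach_work; first by [].
rewrite perform_Act !tape_write_head !zipperR -(cat_rcons y xs).
rewrite -(cat_rcons true zs (nseq (size ys) true)).
have -> : out ++ sd_bits (y :: ys) = rcons (rcons out true) y ++ sd_bits ys.
  by rewrite !cat_rcons.
by case: y; apply: IH.
Qed.

Lemma reach_skip j l xs ys t out :
  reach (OConfig (Skip j) (zipper l xs ys) t out)
        (OConfig (Close j) (zipper l (xs ++ ys) [::]) t (rcons out false)).
Proof.
elim: ys xs => [|y ys IH] xs.
  by rewrite cats0; apply: reach_work; [by []|apply: reach_refl].
apply: reach_work; first by [].
by rewrite perform_Act !tape_write_head zipperR -cat_rcons; apply: IH.
Qed.

Lemma reach_rotate j l l' s out : head None l = None -> head None l' = None ->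
  exists k k', [/\ head None k = None, head None k' = None &
  reach (OConfig (Rewind j) (zipper l s [::])
           (tape_move MoveL (zipper l' (nseq (size s)./2 true) [::])) out)
        (OConfig (if j then Sign false else RotFlag true false)
           (zipper k [::] [::]) (zipper k' [::] [::])
           (out ++ selfdelim (swap_halves s)))].
Proof.
move=> hl hl'; set h := (size s)./2.
have hh : h <= size s by rewrite /h; lia.
(* Rewinding cuts [s] at [size s - h], whereas the later printing from the left stops at [h]; the
   two cuts agree when [size s] is even. *)
set x1 := take (size s - h) s; set x2 := drop (size s - h) s.
have sx2 : size x2 = h by rewrite size_drop subKn.
have sE : s = x1 ++ x2 by rewrite cat_take_drop.
have st : size (take h s) = h by rewrite size_takel.
(* The left parts [k] and [k'] are read off from the final tapes; [Close] has just left a blank next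
   to each head. *)
do 2 eexists; split; last first.
- have := reach_rewind j l x1 x2 [::] [::] out hl'.
  rewrite -sE sx2 !cats0 => /reach_trans; apply.
  apply: reach_trans; first exact: reach_out2.
  apply: reach_trans; first exact: reach_back.
  rewrite cats0 -sE.
  have := reach_out1 j (None :: behead l) (None :: behead l') [::] [::]
    (take h s) (drop h s) (out ++ sd_bits x2).
  rewrite cat_take_drop st => /reach_trans; apply.
  apply: reach_trans; first exact: reach_skip.
  apply: reach_work; first by [].
  rewrite perform_Act cat_take_drop.
  have -> : out ++ selfdelim (swap_halves s) =
            rcons ((out ++ sd_bits x2) ++ sd_bits (take h s)) false.
    rewrite -cats1 /selfdelim /swap_halves -/h -/x2 /sd_bits map_cat.
    by rewrite flatten_cat !catA.
  exact: reach_refl.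
all: by [].
Qed.
End SwapRun.

(** * The transducer without tapes, and its simulation by the machine *)

Definition swap_next (st : swapper * seq bool * seq bool) (b : bool) :
    swapper * seq bool * seq bool :=
  let: (s, buf, out) := st in
  match s with
  | RotFlag j q =>
      if b then (RotBit j q, buf, out)
      else (if j then Sign false else RotFlag true false, [::],
            out ++ selfdelim (swap_halves buf))
  | RotBit j q => (RotFlag j (~~ q), rcons buf b, out)
  | _ => if swap_feed s b is Emit c s' then (s', buf, rcons out c) else st
  end.

Definition swap_waiting (s : swapper) (buf : seq bool) : Prop :=
  match s with
  | RotFlag _ q | RotBit _ q => q = odd (size buf)
  | Flag | Sign _ | Num _ _ _ => buf = [::]
  | _ => False
  end.

(** Links the machine to [swap_next], where the index string sits in a buffer and a whole cycle of
    private work is a single step: the first tape holds the buffer, the second one mark for every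
    two of its bits. *)
Definition swap_good (w : seq bool) (o : oconfig swapper) : Prop :=
  let st := foldl swap_next (Flag, [::], [::]) w in
  swap_waiting st.1.1 st.1.2 /\
  exists l l', [/\ head None l = None, head None l' = None &
    o = OConfig st.1.1 (zipper l st.1.2 [::])
          (zipper l' (nseq (size st.1.2)./2 true) [::]) st.2].

Lemma swap_good_feed M w o b : swap_good w o ->
  exists2 o', swap_good (rcons w b) o' &
    reach Flag swap_work swap_feed M (perform (swap_feed (ostate o) b) o) o'.
Proof.
rewrite /swap_good -cats1 foldl_cat /=.
case: (foldl _ _ w) => -[s buf] out /= [hw [l [l' [hl hl' ->]]]].
(* Common to the states that copy a bit to the output: the buffer is empty and neither tape
   changes. *)
have emit c s' : swap_feed s b = Emit c s' -> buf = [::] ->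
    swap_next (s, buf, out) b = (s', buf, rcons out c) ->
    swap_waiting s' buf ->
  exists2 o', swap_waiting (swap_next (s, buf, out) b).1.1
                (swap_next (s, buf, out) b).1.2 /\
    (exists l l', [/\ head None l = None, head None l' = None &
     o' = OConfig (swap_next (s, buf, out) b).1.1
       (zipper l (swap_next (s, buf, out) b).1.2 [::])
       (zipper l' (nseq (size (swap_next (s, buf, out) b).1.2)./2 true) [::])
       (swap_next (s, buf, out) b).2]) &
    reach Flag swap_work swap_feed M (perform (swap_feed s b)
      (OConfig s (zipper l buf [::]) (zipper l' (nseq (size buf)./2 true) [::])
         out)) o'.
  move=> -> -> -> hs'; eexists; last exact: reach_refl.
  by split=> //; exists l, l'.
case: s hw emit => //=.
- by move=> -> /(_ _ _ erefl erefl erefl); apply; case: b.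
- move=> j q hq _; case: b => /=.
    eexists; last exact: reach_refl.
    by split=> //; exists l, l'.
  have [k [k' [hk hk' hr]]] := reach_rotate M j buf out hl hl'.
  by eexists; last exact: hr; split; [case: j {hr} | exists k, k'].
- move=> j q hq _; eexists; last exact: reach_refl.
  split; first by rewrite size_rcons /= hq.
  (* A mark is added exactly when [q] holds, that is when the old length is odd, which is when half
     the length, rounded down, increases. *)
  exists l, l'; split=> //; rewrite size_rcons /= uphalf_half -hq /perform /=.
  congr OConfig; first by rewrite /zipper map_rcons rev_rcons.
  by case: q {hq}; rewrite /zipper //= map_nseq -[_ :: nseq _ _]/(nseq _.+1 _) !rev_nseq.
- by move=> k -> /(_ _ _ erefl erefl erefl); apply.
- move=> k d [] -> /(_ _ _ erefl erefl erefl); apply=> //.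
  by case: b => //; case: d => //; case: k.
Qed.

(** * Effect of the transducer on matrix codes *)

Definition swap_term (t : term) : term :=
  (swap_halves t.1.1, swap_halves t.1.2, t.2).

Lemma swap_next_num k d out s :
  foldl swap_next (Num k d false, [::], out) (selfdelim s) =
  (if d then (if k then Flag else Sign true) else Num k true false, [::],
   out ++ selfdelim s).
Proof.
elim: s out => [|b s IH] out; first by rewrite /= cats1.
by rewrite [LHS]/= IH /= !cat_rcons.
Qed.

Lemma swap_next_rot j q buf out s :
  foldl swap_next (RotFlag j q, buf, out) (selfdelim s) =
  (if j then Sign false else RotFlag true false, [::],
   out ++ selfdelim (swap_halves (buf ++ s))).
Proof.
elim: s q buf => [|b s IH] q buf; first by rewrite /= cats0.
by rewrite [LHS]/= IH cat_rcons.
Qed.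

Lemma swap_next_rat k out a :
  foldl swap_next (Sign k, [::], out) (rat_code a) =
  (if k then Flag else Sign true, [::], out ++ rat_code a).
Proof.
by rewrite /rat_code /= foldl_cat !swap_next_num cat_rcons -catA /= -cat_rcons.
Qed.

Lemma swap_next_term out t :
  foldl swap_next (Flag, [::], out) (term_code t) =
  (Flag, [::], out ++ term_code (swap_term t)).
Proof.
rewrite [LHS]/= foldl_cat swap_next_rot foldl_cat swap_next_rot foldl_cat.
by rewrite !swap_next_rat -cats1 /term_code /selfdelim -!catA.
Qed.

Lemma mx_code_cons t l : mx_code (t :: l) = term_code t ++ mx_code l.
Proof. by rewrite /mx_code catA. Qed.

Lemma swap_next_mx out l :
  foldl swap_next (Flag, [::], out) (mx_code l) =
  (Flag, [::], out ++ mx_code (map swap_term l)).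
Proof.
elim: l out => [|t l IH] out; first by rewrite /= cats1.
by rewrite [map _ _]/= !mx_code_cons foldl_cat swap_next_term IH catA.
Qed.

Lemma swap_next_flatten out ls :
  foldl swap_next (Flag, [::], out) (flatten (map mx_code ls)) =
  (Flag, [::], out ++ flatten [seq mx_code (map swap_term l) | l <- ls]).
Proof.
elim: ls out => [|l ls IH] out; first by rewrite /= cats0.
by rewrite /= foldl_cat swap_next_mx IH catA.
Qed.

(** Output is only ever appended, so what has been printed survives any further input. *)
Lemma swap_next_prefix st w : prefix st.2 (foldl swap_next st w).2.
Proof.
elim: w st => [|b w IH] st; first exact: prefix_refl.
apply: prefix_trans (IH _).
case: st => -[s buf] out /=.
case: s => //= *; try case: b; try case: ifP => //;
  by rewrite /= ?prefix_refl ?prefix_prefix -?cats1 ?prefix_prefix.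
Qed.

(** At a waiting configuration the transducer has processed all bits that [M] has written by step
    [k]; the codes of [ls] come first among these, and the rest only extends the result. Hence [M]
    need not halt. *)
Lemma swap_machine (M : machine) : exists T : machine, forall y p ls,
  emits M y p (flatten (map mx_code ls)) ->
  emits T y p (flatten [seq mx_code (map swap_term l) | l <- ls]).
Proof.
exists (postprocess Flag swap_work swap_feed M) => y p ls [k].
case/prefixP => w hw.
have h0 : swap_good [::] (OConfig Flag (tape_of [::]) (tape_of [::]) [::]).
  by split=> //; exists [::], [::].
have hwait v o : swap_good v o ->
    swap_work (ostate o) (thead (otape1 o)) (thead (otape2 o)) = None.
  by move=> [h [l [l' [_ _ ->]]]] /=; case: (foldl _ _ _).1.1 h.
have [m [ o [ho hm]]] :=
  postprocess_run h0 hwait (swap_good_feed M) y p k.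
exists m; rewrite hm /=.
case: ho => _ [l [l' [_ _ ->]]] /=; rewrite hw foldl_cat swap_next_flatten /=.
exact: (swap_next_prefix (Flag, [::], _)).
Qed.

Import Order.TTheory GRing.Theory Num.Theory.
Import numFieldNormedType.Exports.
Local Open Scope classical_set_scope.
Local Open Scope ring_scope.

(** * Unique decoding *)

(** The arbitrary continuations [u] and [v] combine injectivity with prefix-freeness, which makes
    the property pass to concatenations of codes. *)
Definition decodable (T : Type) (code : T -> seq bool) : Prop :=
  forall x y u v, code x ++ u = code y ++ v -> x = y /\ u = v.

Lemma decodable_selfdelim : decodable selfdelim.
Proof.
by rewrite /decodable /selfdelim; elim=> [|a s IH] [|b t] u v //= [] // -> /IH[->].
Qed.

Lemma pos_bits_nil p : pos_bits p <> [::].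
Proof. by case: p => //= p; case: (pos_bits p). Qed.

Lemma pos_bits_inj : injective pos_bits.
Proof.
elim=> [p IH|p IH|] [q|q|] //=.
- by move/rcons_inj => [/IH ->].
- by move/rcons_inj => [].
- by rewrite -[[:: true]]/(rcons [::] true) => /rcons_inj[/pos_bits_nil].
- by move/rcons_inj => [].
- by move/rcons_inj => [/IH ->].
- by rewrite -[[:: true]]/(rcons [::] true) => /rcons_inj[/pos_bits_nil].
- by rewrite -[[:: true]]/(rcons [::] true) => /rcons_inj[/esym/pos_bits_nil].
- by rewrite -[[:: true]]/(rcons [::] true) => /rcons_inj[/esym/pos_bits_nil].
Qed.

Lemma nat_bits_inj : injective nat_bits.
Proof.
move=> m n; rewrite /nat_bits => h; apply: Nnat.Nat2N.inj.
move: h; case: (BinNat.N.of_nat m) => [|p]; case: (BinNat.N.of_nat n) => [|q] //.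
- by move=> /esym/pos_bits_nil.
- by move=> /pos_bits_nil.
by move=> /pos_bits_inj ->.
Qed.

Lemma decodable_rat : decodable rat_code.
Proof.
move=> x y u v; rewrite /rat_code !cat_cons -!(catA (selfdelim _)) => -[hs].
move=> /decodable_selfdelim[/nat_bits_inj hn /decodable_selfdelim[/nat_bits_inj hd ->]].
split=> //; rewrite -[x]divq_num_den -[y]divq_num_den.
rewrite [numq x]intEsign [numq y]intEsign hs hn.
by rewrite -(absz_denq x) -(absz_denq y) hd.
Qed.

Lemma decodable_term : decodable term_code.
Proof.
move=> [[r s] [x y]] [[r' s'] [x' y']] u v; rewrite /term_code !cat_cons.
rewrite -!(catA (selfdelim _)) /crat_code -!(catA (rat_code _)).
move=> -[/decodable_selfdelim[/= -> /decodable_selfdelim[->]]].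
by move=> /decodable_rat[-> /decodable_rat[-> ->]].
Qed.

Lemma decodable_mx : decodable mx_code.
Proof.
elim=> [|t l IH] [|t' l'] u v; first by case.
- by rewrite mx_code_cons.
- by rewrite mx_code_cons.
by rewrite !mx_code_cons -!(catA (term_code _)) => /decodable_term[-> /IH[-> ->]].
Qed.

Lemma decodable_flatten (T : Type) (code : T -> seq bool) (L L' : nat -> T) m k u v :
    decodable code ->
    flatten [seq code (L i) | i <- iota m k] ++ u =
    flatten [seq code (L' i) | i <- iota m k] ++ v ->
  forall i, (m <= i < m + k)%N -> L i = L' i.
Proof.
move=> hc; elim: k m u v => [|k IH] m u v /=.
  by move=> _ i; rewrite addn0 => /andP[/leq_ltn_trans h /h]; rewrite ltnn.
rewrite -!catA => /hc[h0 /IH hS] i; rewrite leq_eqVlt => /andP[/orP[/eqP <- //|hi] hi'].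
by apply: hS; rewrite hi addSnnS.
Qed.

Lemma prefix_coutput M y p j k :
  prefix (coutput (run M y p j)) (coutput (run M y p (j + k))).
Proof.
elim: k => [|k IH]; first by rewrite addn0 prefix_refl.
rewrite addnS; apply: prefix_trans IH _.
rewrite [run M y p (j + k).+1]/(step (run M y p (j + k))) /step.
case: (cinstr _) => [|f|b s|s m a] /=; rewrite ?prefix_refl ?prefix_rcons //.
by case: (cinput _); rewrite /= prefix_refl.
Qed.

(** Both words are initial segments of the output at step [j + k]. *)
Lemma emits_joint M y p w w' : emits M y p w -> emits M y p w' ->
  exists u v, w ++ u = w' ++ v.
Proof.
move=> [j hj] [k hk].
have /prefixP[u hu] := prefix_trans hj (prefix_coutput M y p j k).
have /prefixP[v hv] := prefix_trans hk (prefix_coutput M y p k j).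
by exists u, v; rewrite -hu -hv addnC.
Qed.

(** By unique decoding the output of [q] determines the approximations one by one, and a sequence of
    matrices has at most one limit. *)
Lemma lower_computes_unique (R : realType) U N q (X X' : 'M[R[i]]_(2 ^ N)) :
  lower_computes U q X -> lower_computes U q X' -> X = X'.
Proof.
move=> [_ [L [_ _ cL eL]]] [_ [L' [_ _ cL' eL']]].
have LE : L = L'.
  apply/funext => i.
  (* The first [i.+1] codes are compared so that entry [i] is among them. *)
  have [u [v]] := emits_joint (eL i.+1) (eL' i.+1).
  by move/(decodable_flatten decodable_mx); apply; rewrite /= add0n.
rewrite -{}LE in cL'; apply/matrixP => i j.
have [cr ci] := cL i j; have [cr' ci'] := cL' i j.
have hr := norm_cvg_unique cr cr'; have hi := norm_cvg_unique ci ci'.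
by move: hr hi; case: (X i j) => a b; case: (X' i j) => a' b' /= -> ->.
Qed.

(** * Kraft's inequality *)

Section PrefixFree.
Variables (M : machine) (y : seq bool).

Definition feed_more (z : seq bool) (c : config M) : config M :=
  Config (cstate c) (cinput c ++ z) (caux c) (cwork c) (coutput c).

Lemma iter_step_halted (c : config M) k : halted c -> iter k (@step M) c = c.
Proof.
move=> hc; elim: k => //= k ->; rewrite /step.
by move: hc; rewrite /halted; case: (cinstr c).
Qed.

(** Longer input can matter only at a read from exhausted input, and there the machine is blocked
    and never halts. *)
Lemma step_feed_more z c :
  step (feed_more z c) = feed_more z (step c) \/
  (forall k, ~~ halted (iter k (@step M) c)).
Proof.
case E: (cinstr c) => [|f|b s|s m a].
- by left; rewrite /step -[cinstr (feed_more z c)]/(cinstr c) E.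
- case I: (cinput c) => [|b p]; [right|left].
    move=> k; have -> : iter k (@step M) c = c.
      by elim: k => //= k ->; rewrite /step E I.
    by rewrite /halted E.
  by rewrite /step -[cinstr (feed_more z c)]/(cinstr c) E /= I.
- by left; rewrite /step -[cinstr (feed_more z c)]/(cinstr c) E.
- by left; rewrite /step -[cinstr (feed_more z c)]/(cinstr c) E.
Qed.

Lemma run_feed_more p z k : halted (run M y p k) ->
  run M y (p ++ z) k = feed_more z (run M y p k).
Proof.
move=> hk; suff H j : (j <= k)%N -> run M y (p ++ z) j = feed_more z (run M y p j).
  exact: H.
elim: j => [|j IH] hj; first by [].
rewrite -[LHS]/(step (run M y (p ++ z) j)) IH 1?ltnW //.
have [-> //|/(_ (k - j)%N)] := step_feed_more z (run M y p j).
by rewrite /run -iterD subnK 1?ltnW // -/(run M y p k) hk.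
Qed.

(** The halting run on [p] is also the run on [p ++ z] with [z] left unread. Halted configurations
    are final, so the two runs end alike, and the second has consumed all its input. *)
Lemma computes_prefix_free p z x x' :
  computes M y p x -> computes M y (p ++ z) x' -> z = [::] /\ x = x'.
Proof.
move=> [k [hk ik ok]] [j [hj ij oj]].
have hz : halted (run M y (p ++ z) k) by rewrite run_feed_more.
have E : run M y (p ++ z) k = run M y (p ++ z) j.
  rewrite -(iter_step_halted j hz) -(iter_step_halted k hj).
  by rewrite /run -!iterD addnC.
move: E; rewrite run_feed_more // => E.
by move: ij oj; rewrite -E /= ik ok cat0s => -> ->.
Qed.

End PrefixFree.

(** Induction on a bound for the lengths. If the empty word occurs, it is the only one; otherwise
    the words are split by their first bit, and each half, with that bit removed, is again
    prefix-free and contributes at most 1/2. *)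
Lemma kraft_seq (R : realFieldType) (s : seq (seq bool)) : uniq s ->
    (forall p z, p \in s -> p ++ z \in s -> z = [::]) ->
  \sum_(p <- s) (2^-1 : R) ^+ size p <= 1.
Proof.
move=> us pf; have : forall p, p \in s -> (size p < (\max_(p <- s) size p).+1)%N.
  by move=> p ps; rewrite ltnS; apply: leq_bigmax_seq.
move: us pf; move: (\max_(p <- s) size p).+1 => n.
elim: n s => [|n IH] s us pf hn.
  by rewrite big1_seq ?ler01 // => p /andP[_ /hn].
have [s0|s0] := boolP ([::] \in s).
  have -> : s = [:: [::]].
    apply/perm_small_eq => //; apply: uniq_perm => // p.
    rewrite inE; apply/idP/eqP => [hp|-> //].
    exact: (pf [::] p).
  by rewrite big_seq1 expr0.
(* The default [~~ b] keeps the empty word out of both halves. *)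
pose f b := [seq behead p | p <- s & head (~~ b) p == b].
have hf b p : (p \in f b) = (b :: p \in s).
  apply/mapP/idP => [[q]|h]; last by exists (b :: p); rewrite ?mem_filter //= eqxx.
  rewrite mem_filter => /andP[hq qs ->].
  case: q hq qs => [|c q] /=; first by case: b.
  by move=> /eqP ->.
have hfs b : \sum_(p <- f b) (2^-1 : R) ^+ size p <= 1.
  apply: IH.
  - rewrite map_inj_in_uniq ?filter_uniq // => p q.
    rewrite !mem_filter => /andP[hp ps] /andP[hq qs].
    case: p hp ps => [|c p] /=; first by case: b hq.
    case: q hq qs => [|d q] /=; first by case: b.
    by move=> /eqP -> _ /eqP -> _ ->.
  - by move=> p z; rewrite !hf => /pf h /h.
  - by move=> p; rewrite hf => /hn.
have -> : \sum_(p <- s) (2^-1 : R) ^+ size p =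
  \sum_(p <- f true) (2^-1 : R) ^+ (size p).+1 +
  \sum_(p <- f false) (2^-1 : R) ^+ (size p).+1.
  rewrite !big_map !big_filter [LHS](bigID (fun p => head false p)) /=.
  have szE p : p \in s -> size p = (size (behead p)).+1.
    by case: p => // hp; rewrite hp in s0.
  congr (_ + _); rewrite big_seq_cond [RHS]big_seq_cond; apply: eq_big => p.
  - by case: (p \in s) => //=; case: (head _ _).
  - by move=> /andP[ps _]; rewrite szE.
  - by case: p => [|[] p] //=; rewrite (negPf s0).
  - by move=> /andP[ps _]; rewrite szE.
rewrite -[leRHS](_ : 2^-1 * 1 + 2^-1 * 1 = 1 :> R); last first.
  by rewrite mulr1 -mulr2n -[_ *+ 2]mulr_natr mulVf.
under eq_bigr do rewrite exprS; rewrite -mulr_sumr.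
under [X in _ + X]eq_bigr do rewrite exprS; rewrite -mulr_sumr.
by apply: lerD; apply: ler_wpM2l.
Qed.

(** * Sums over sets *)

Section Esum.
Context {R : realType} {T : choiceType}.
Implicit Types (I : set T) (a : T -> \bar R).
Local Open Scope ereal_scope.

(** The common tool for comparing sums: an injective reindexing that loses at most a factor [c] per
    term. It is checked on finite subsets of [I], whose images lie in [J]. *)
Lemma esum_le_scaled (T' : choiceType) I (J : set T') (e : T -> T') c a
    (b : T' -> \bar R) :
    (0 <= c)%R -> set_inj I e -> (forall i, I i -> J (e i)) ->
    (forall j, J j -> 0 <= b j) ->
    (forall i, I i -> a i <= c%:E * b (e i)) ->
  \esum_(i in I) a i <= c%:E * \esum_(j in J) b j.
Proof.
move=> c0 ei IJ b0 ab; apply: ge_ereal_sup => _ [X [fX XI] <-].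
have bX : \sum_(i \in X) b (e i) <= \esum_(j in J) b j.
  apply: le_trans (_ : \esum_(i in I) b (e i) <= _).
    by apply: ereal_sup_ubound; exists X.
  rewrite -(esum_image I e b) //.
  apply: ge_ereal_sup => _ [Y [fY YI] <-]; apply: ereal_sup_ubound.
  by exists Y => //; split=> // _ /YI[i /IJ Ji <-].
apply: le_trans (lee_wpmul2l _ bX); last by rewrite lee_fin.
rewrite !fsbig_finite //= big_seq [X in _ * X]big_seq ge0_sume_distrr.
  by apply: lee_sum => i; rewrite in_fset_set // inE => /XI/ab.
by move=> i; rewrite in_fset_set // inE => /XI/IJ/b0.
Qed.

Lemma esumZ I c a : (0 <= c)%R -> (forall i, I i -> 0 <= a i) ->
  \esum_(i in I) (c%:E * a i) = c%:E * \esum_(i in I) a i.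
Proof.
move=> c0 a0; apply/eqP; rewrite eq_le; apply/andP; split.
  exact: (@esum_le_scaled _ _ _ id).
have [->|cn0] := eqVneq c 0%R.
  by rewrite mul0e esum_ge0 // => i Ii; rewrite mul0e.
have {}c0 : (0 < c)%R by rewrite lt_neqAle eq_sym cn0.
(* The reverse inequality is the same comparison with the factor [c^-1]. *)
rewrite -lee_pdivlMl //.
apply: (@esum_le_scaled _ _ _ id) => //.
- by rewrite invr_ge0 ltW.
- by move=> i Ii; rewrite mule_ge0 ?a0 // lee_fin ltW.
- by move=> i Ii; rewrite muleA -EFinM mulVf ?mul1e // gt_eqF.
Qed.

End Esum.

(** The double sum runs over pairs, and disjointness of the sets [J i] makes the second projection
    injective on them. *)
Lemma esum_disjoint (R : realType) (T1 T2 : choiceType) (I : set T1)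
    (J : T1 -> set T2) (K : set T2) (a : T2 -> \bar R) :
    (forall i j, I i -> J i j -> K j) ->
    (forall i i' j, I i -> I i' -> J i j -> J i' j -> i = i') ->
    (forall j, 0 <= a j)%E ->
  (\esum_(i in I) \esum_(j in J i) a j <= \esum_(j in K) a j)%E.
Proof.
move=> JK dJ a0; rewrite (@esum_esum _ _ _ _ _ (fun=> a)) //.
rewrite -(mul1e (\esum_(j in K) a j)).
apply: (@esum_le_scaled _ _ _ _ _ snd) => //.
- move=> [i j] [i' j'] /[!inE] -[/= Ii Jij] [/= Ii' Jij'] jj'.
  by rewrite -jj' in Jij' *; rewrite (dJ i i' j).
- by move=> [i j] [/= /JK h /h].
- by move=> [i j] _; rewrite mul1e.
Qed.

(** * Universal probabilities *)

Lemma kraft (R : realType) (M : machine) (y : seq bool) :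
  (\esum_(p in [set p | exists x, computes M y p x]) ((2^-1 : R) ^+ size p)%:E
     <= 1)%E.
Proof.
apply: ge_ereal_sup => _ [X [fX XI] <-].
rewrite fsbig_finite //= sumEFin lee_fin; apply: kraft_seq => [|p z].
  exact: finmap.fset_uniq.
rewrite !in_fset_set // !inE => /XI[x hx] /XI[x' hx'].
by have [] := computes_prefix_free hx hx'.
Qed.

Section Weights.
Variables (R : realType) (U : machine).
Local Open Scope ereal_scope.

Lemma uprob_ge0 x y : 0 <= uprob R U x y.
Proof. by apply: esum_ge0 => p _; rewrite lee_fin exprn_ge0. Qed.

Lemma lprob_ge0 N (X : 'M[R[i]]_(2 ^ N)) y : 0 <= lprob U X y.
Proof. by apply: esum_ge0 => q _; exact: uprob_ge0. Qed.

Lemma esum_uprob_le1 y (D : set (seq bool)) :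
  \esum_(x in D) uprob R U x y <= 1.
Proof.
apply: le_trans (kraft R U y); apply: esum_disjoint.
- by move=> x p _ hx; exists x.
- move=> x x' p _ _ /= hx hx'.
  (* Prefix-freeness with the empty extension says that a program has at most one output. *)
  have [] // := @computes_prefix_free U y p [::] x x' hx.
  by rewrite cats0.
- by move=> p; rewrite lee_fin exprn_ge0.
Qed.

Lemma esum_lprob_le1 N y (D : set 'M[R[i]]_(2 ^ N)) :
  \esum_(X in D) lprob U X y <= 1.
Proof.
apply: le_trans (esum_uprob_le1 y setT); apply: esum_disjoint => //.
- by move=> X X' q _ _; exact: lower_computes_unique.
- by move=> q; exact: uprob_ge0.
Qed.

Lemma lprob_fin_num N (X : 'M[R[i]]_(2 ^ N)) y : lprob U X y \is a fin_num.
Proof.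
rewrite ge0_fin_numE ?lprob_ge0 //.
rewrite (le_lt_trans _ (ltry 1)) // -(esum_set1 (a := fun X => lprob U X y) (t := X)) ?lprob_ge0 //.
exact: esum_lprob_le1.
Qed.

(** Each program [p] for [q] yields the program [u ++ p] for [t ++ q], whose weight is smaller by
    the factor 2^-|u|. *)
Lemma uprob_print t T u q y :
    (forall y p x, computes U y p x -> computes T y p (t ++ x)) ->
    (forall y p x, computes T y p x -> computes U y (u ++ p) x) ->
  uprob R U q y <= (2 ^+ size u)%:E * uprob R U (t ++ q) y.
Proof.
move=> hT hU; apply: (@esum_le_scaled _ _ _ _ _ (cat u)).
- by rewrite exprn_ge0.
- move=> p p' _ _ /eqP; rewrite eqseq_cat // => /andP[_ /eqP //].
- by move=> p /hT/hU.
- by move=> p _; rewrite lee_fin exprn_ge0.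
- move=> p _; rewrite -EFinM lee_fin size_cat exprD mulrA.
  by rewrite -exprMn mulfV // expr1n mul1r.
Qed.

Lemma lprob_translate N N' (X : 'M[R[i]]_(2 ^ N)) (X' : 'M[R[i]]_(2 ^ N'))
    t c y : (0 <= c)%R ->
    (forall q, lower_computes U q X -> lower_computes U (t ++ q) X') ->
    (forall q, uprob R U q y <= c%:E * uprob R U (t ++ q) y) ->
  lprob U X y <= c%:E * lprob U X' y.
Proof.
move=> c0 hX hq; apply: (@esum_le_scaled _ _ _ _ _ (cat t)) => //.
- by move=> p p' _ _ /eqP; rewrite eqseq_cat // => /andP[_ /eqP //].
- by move=> *; exact: uprob_ge0.
Qed.

End Weights.

(** * Linearity of [rsum] *)

Section Rsum.
Variables (R : realType) (T : choiceType) (D : set T).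
Implicit Types f g h : T -> R.

Definition rsummable f := summable D (EFin \o f).

Lemma rsummable0 : rsummable (fun=> 0).
Proof.
by rewrite /rsummable /summable esum1 ?ltry // => x _; rewrite /= normr0.
Qed.

Lemma rsummable_fin_num f : rsummable f -> (forall x, D x -> 0 <= f x) ->
  \esum_(x in D) (f x)%:E \is a fin_num.
Proof.
rewrite /rsummable summableE => h f0.
rewrite (eq_esum (b := fun x => `|(EFin \o f) x|%E)) // => x Dx.
by rewrite gee0_abs // lee_fin f0.
Qed.

(** [rsum] can be evaluated on any splitting into a difference of nonnegative summable functions,
    not just on the positive and negative parts. Linearity then follows by choosing suitable
    splittings. *)
Lemma rsum_diff g h : rsummable g -> rsummable h ->
    (forall x, D x -> 0 <= g x) -> (forall x, D x -> 0 <= h x) ->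
  rsum D (fun x => g x - h x) =
  fine (\esum_(x in D) (g x)%:E) - fine (\esum_(x in D) (h x)%:E).
Proof.
move=> sg sh g0 h0.
have B : ((\esum_(x in D) ((g \- h)^\+ x)%:E) - (\esum_(x in D) ((g \- h)^\- x)%:E) =
    \esum_(x in D) (g x)%:E - \esum_(x in D) (h x)%:E)%E.
  have := @esumB _ _ D (EFin \o g) (EFin \o h) sg sh.
  rewrite -[((EFin \o g) \- (EFin \o h))%E]/(EFin \o (g \- h)) funerpos funerneg.
  by apply.
have sgh : rsummable (g \- h) by apply: (summableB sg sh).
have fp : (\esum_(x in D) ((g \- h)^\+ x)%:E) \is a fin_num.
  apply: rsummable_fin_num => //.
  by have := summable_funepos sgh; rewrite funerpos.
have fn : (\esum_(x in D) ((g \- h)^\- x)%:E) \is a fin_num.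
  apply: rsummable_fin_num => //.
  by have := summable_funeneg sgh; rewrite funerneg.
by rewrite -[LHS]/(rsum D (g \- h)) /rsum -fineB // B fineB ?rsummable_fin_num //.
Qed.

Lemma rsum_ge0E f : rsummable f -> (forall x, D x -> 0 <= f x) ->
  rsum D f = fine (\esum_(x in D) (f x)%:E).
Proof.
move=> sf f0; have s0 := rsummable0.
transitivity (rsum D (fun x => f x - 0)).
  by congr rsum; apply/funext => x; rewrite subr0.
by rewrite rsum_diff // [X in _ - fine X]esum1 // subr0.
Qed.

Lemma rsummableD f g : rsummable f -> rsummable g ->
  rsummable (fun x => f x + g x).
Proof. exact: summableD. Qed.

Lemma rsummableZ c f : rsummable f -> rsummable (fun x => c * f x).
Proof.
rewrite /rsummable /summable => sf.
rewrite (eq_esum (b := fun x => (`|c|%:E * `|(EFin \o f) x|)%E)).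
  by rewrite esumZ // lte_mul_pinfty // lee_fin.
by move=> x _ /=; rewrite normrM EFinM.
Qed.

Lemma rsummable_funrpos f : rsummable f -> rsummable f^\+.
Proof. by move=> /summable_funepos; rewrite funerpos. Qed.

Lemma rsummable_funrneg f : rsummable f -> rsummable f^\-.
Proof. by move=> /summable_funeneg; rewrite funerneg. Qed.

Lemma funrposBnegE f x : f x = f^\+ x - f^\- x.
Proof. by rewrite -{1}(funrposBneg f). Qed.

Lemma rsumD f g : rsummable f -> rsummable g ->
  rsum D (fun x => f x + g x) = rsum D f + rsum D g.
Proof.
move=> sf sg.
have [fp fn] := (rsummable_funrpos sf, rsummable_funrneg sf).
have [gp gn] := (rsummable_funrpos sg, rsummable_funrneg sg).
transitivity (rsum D (fun x => (f^\+ x + g^\+ x) - (f^\- x + g^\- x))).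
  congr rsum; apply/funext => x.
  by rewrite opprD addrACA -!funrposBnegE.
rewrite rsum_diff; first last.
- by move=> x _; rewrite addr_ge0.
- by move=> x _; rewrite addr_ge0.
- exact: rsummableD.
- exact: rsummableD.
under eq_esum do rewrite EFinD.
under [X in _ - fine X]eq_esum do rewrite EFinD.
have pos := funrpos_ge0; have neg := funrneg_ge0.
rewrite !esumD; try by move=> x _; rewrite lee_fin.
by rewrite !fineD ?rsummable_fin_num // /rsum opprD addrACA.
Qed.

Lemma rsumZ c f : rsummable f -> rsum D (fun x => c * f x) = c * rsum D f.
Proof.
move=> sf; have [fp fn] := (rsummable_funrpos sf, rsummable_funrneg sf).
have zE d g : 0 <= d -> rsummable g -> (forall x, D x -> 0 <= g x) ->
    fine (\esum_(x in D) (d * g x)%:E) = d * fine (\esum_(x in D) (g x)%:E).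
  move=> d0 sg g0; under eq_esum do rewrite EFinM.
  by rewrite esumZ // fineM // rsummable_fin_num.
have [c0|c0] := leP 0 c.
  transitivity (rsum D (fun x => c * f^\+ x - c * f^\- x)).
    by congr rsum; apply/funext => x; rewrite funrposBnegE mulrBr.
  rewrite rsum_diff ?zE //; try exact: rsummableZ.
  - by rewrite -mulrBr.
  - by move=> x _; rewrite mulr_ge0.
  - by move=> x _; rewrite mulr_ge0.
have {}c0 : 0 <= - c by rewrite oppr_ge0 ltW.
(* For negative [c] the positive and negative parts exchange their roles. *)
transitivity (rsum D (fun x => - c * f^\- x - - c * f^\+ x)).
  by congr rsum; apply/funext => x; rewrite funrposBnegE -mulrBr mulNr -mulrN opprB.
rewrite rsum_diff ?zE //; try exact: rsummableZ.
- by rewrite -mulrBr mulNr -mulrN opprB.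
- by move=> x _; rewrite mulr_ge0.
- by move=> x _; rewrite mulr_ge0.
Qed.

Lemma rsum_sum (I : Type) (r : seq I) (F : I -> T -> R) :
    (forall i, rsummable (F i)) ->
  rsummable (fun x => \sum_(i <- r) F i x) /\
  rsum D (fun x => \sum_(i <- r) F i x) = \sum_(i <- r) rsum D (F i).
Proof.
move=> sF; have e0 : (fun x => \sum_(i <- [::]) F i x) = fun=> 0.
  by apply/funext => x; rewrite big_nil.
have s0 := rsummable0.
elim: r => [|i r [sr IH]].
  rewrite e0 big_nil; split=> //.
  by rewrite rsum_ge0E // esum1.
have -> : (fun x => \sum_(j <- i :: r) F j x) =
          (fun x => F i x + \sum_(j <- r) F j x).
  by apply/funext => x; rewrite big_cons.
by rewrite rsumD // big_cons IH; split=> //; apply: rsummableD.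
Qed.

End Rsum.
Local Open Scope sesquilinear_scope.

(** * Positive semidefinite matrices *)

Lemma cReD (R : realType) (x y : R[i]) :
  complex.Re (x + y) = complex.Re x + complex.Re y.
Proof. by case: x; case: y. Qed.

Lemma cReM (R : realType) (x y : R[i]) : complex.Re (x * y) =
  complex.Re x * complex.Re y - complex.Im x * complex.Im y.
Proof. by case: x; case: y. Qed.

Lemma cRe_sum (R : realType) (I : Type) (r : seq I) (F : I -> R[i]) :
  complex.Re (\sum_(i <- r) F i) = \sum_(i <- r) complex.Re (F i).
Proof. by apply: (big_morph _ (@cReD R)). Qed.

Section Psd.
Variables (R : realType) (d : nat).
Local Notation C := R[i].
Implicit Types (A X : 'M[C]_d).

Definition qform A (u v : 'cV[C]_d) : C := (u ^t* *m A *m v) 0 0.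

Lemma qform_delta A i j : qform A (delta_mx i 0) (delta_mx j 0) = A i j.
Proof.
rewrite /qform trmx_delta.
have -> : map_mx Num.conj (delta_mx 0 i) = delta_mx 0 i :> 'rV[C]_d.
  by apply/matrixP => a b; rewrite !mxE rmorph_nat.
by rewrite -rowE -colE !mxE.
Qed.

Lemma qformD A u v c : qform A (u + c *: v) (u + c *: v) =
  qform A u u + c * qform A u v + c^* * qform A v u + c^* * c * qform A v v.
Proof.
rewrite /qform; have -> : (u + c *: v) ^t* = u ^t* + c^* *: v ^t*.
  by apply/matrixP => a b; rewrite !mxE rmorphD rmorphM.
have zE (a : C) (M : 'M[C]_1) : (a *: M) 0 0 = a * M 0 0 by rewrite mxE.
have dE (M N : 'M[C]_1) : (M + N) 0 0 = M 0 0 + N 0 0 by rewrite mxE.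
rewrite !mulmxDl !mulmxDr -!scalemxAl -!scalemxAr !(dE, zE).
by rewrite !addrA mulrA.
Qed.

Lemma psd_pair A i j (c : C) : psd A ->
  0 <= A i i + c * A i j + c^* * A j i + c^* * c * A j j.
Proof.
by move=> /(_ (delta_mx i 0 + c *: delta_mx j 0)); rewrite -/(qform _ _ _) qformD !qform_delta.
Qed.

Lemma psd_diag A i : psd A -> 0 <= A i i.
Proof. by move=> /(_ (delta_mx i 0)); rewrite -/(qform _ _ _) qform_delta. Qed.

(** Polarisation: the form is evaluated at e_i + c e_j for c = 1, -1, i, -i. Vanishing imaginary
    parts give the symmetry, and nonnegative real parts give the bounds. *)
Lemma psd_entries A i j : psd A ->
  [/\ complex.Re (A i j) = complex.Re (A j i),
      complex.Im (A i j) = - complex.Im (A j i),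
      `|complex.Re (A i j)| *+ 2 <= complex.Re (A i i) + complex.Re (A j j) &
      `|complex.Im (A i j)| *+ 2 <= complex.Re (A i i) + complex.Re (A j j)].
Proof.
move=> pA; have := psd_pair i j (Complex 0 1) pA.
have := psd_pair i j (Complex 0 (-1)) pA.
have := psd_pair i j 1 pA; have := psd_pair i j (-1) pA.
have := psd_diag i pA; have := psd_diag j pA.
case: (A i i) => a a'; case: (A j j) => b b'.
case: (A i j) => x x'; case: (A j i) => y y'.
rewrite /Num.conj /= !lecE /=.
move=> /andP[/eqP b0 _] /andP[/eqP a0 _] /andP[/eqP e1 l1] /andP[/eqP e2 l2].
move=> /andP[/eqP e3 l3] /andP[/eqP e4 l4].
have xy : x = y by lra.
have xy' : x' = - y' by lra.
by split=> //; rewrite -normrMn ler_norml; apply/andP; split; lra.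
Qed.

(** Diagonal entries are nonnegative and sum to at most 1; they control the others through
    [psd_entries]. *)
Lemma semi_density_entries A i j : semi_density A ->
  `|complex.Re (A i j)| <= 1 /\ `|complex.Im (A i j)| <= 1.
Proof.
move=> [pA tA].
have dg k : 0 <= complex.Re (A k k).
  by have := psd_diag k pA; rewrite lecE => /andP[].
have tr1 : \sum_k complex.Re (A k k) <= 1.
  by move: tA; rewrite lecE /mxtrace cRe_sum => /andP[].
have d1 k : complex.Re (A k k) <= 1.
  apply: le_trans tr1; rewrite (bigD1 k) //= lerDl.
  exact: sumr_ge0.
have [_ _ hr hi] := psd_entries i j pA.
have [di dj] := (d1 i, d1 j).
by split; [move: hr | move: hi]; set z := `|_|; lra.
Qed.

Lemma psd_hermitian A : psd A -> A ^t* = A.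
Proof.
move=> pA; apply/matrixP => i j; rewrite !mxE.
have [hr hi _ _] := psd_entries i j pA.
by move: hr hi; case: (A i j) => x x'; case: (A j i) => y y' /= -> ->; rewrite /Num.conj.
Qed.

(** Spectral theorem: [K] is the adjoint of the diagonalising unitary times the square roots of the
    eigenvalues, which are nonnegative as values of the form on eigenvectors. *)
Lemma psd_factor A : psd A -> exists K : 'M[C]_d, A = K *m K ^t*.
Proof.
move=> pA; have hA := psd_hermitian pA.
have nA : A \is normalmx by apply/normalmxP; rewrite hA.
have /orthomx_spectralP := nA.
set P := spectralmx A; set s := spectral_diag A => AE.
have uP : P \is unitarymx := spectral_unitarymx A.
rewrite invmx_unitary // in AE.
have PP : P *m P ^t* = 1%:M by apply/unitarymxP.
have DE : diag_mx s = P *m A *m P ^t*.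
  by rewrite [in RHS]AE !mulmxA PP mul1mx -mulmxA PP mulmx1.
have s0 k : 0 <= s 0 k.
  pose v : 'cV[C]_d := delta_mx k 0; have := pA (P ^t* *m v).
  have -> : (P ^t* *m v) ^t* = v ^t* *m P.
    by rewrite trmx_mul map_mxM trmxCK.
  rewrite -!mulmxA [A *m _]mulmxA [P *m _]mulmxA [P *m _]mulmxA -DE mulmxA.
  by rewrite -/(qform _ _ _) qform_delta !mxE eqxx mulr1n.
exists (P ^t* *m diag_mx (\row_k sqrtC (s 0 k))).
rewrite trmx_mul map_mxM trmxCK tr_diag_mx map_diag_mx.
rewrite -!mulmxA [diag_mx _ *m (diag_mx _ *m _)]mulmxA mulmx_diag {1}AE -mulmxA.
congr (_ *m (diag_mx _ *m _)); apply/rowP => k; rewrite !mxE.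
by rewrite /= conj_Creal ?ger0_real ?sqrtC_ge0 // -expr2 sqrtCK.
Qed.

(** By cyclicity the trace is the sum of the values of the form of [A] on the columns of [W]. *)
Lemma psd_trace_ge0 A m (W : 'M[C]_(d, m)) : psd A ->
  0 <= \tr (A *m (W *m W ^t*)).
Proof.
move=> pA; rewrite mulmxA mxtrace_mulC mulmxA; apply: sumr_ge0 => k _.
have := pA (col k W).
have -> : (col k W) ^t* = row k (W ^t*).
  by apply/matrixP => a b; rewrite !mxE.
have -> : (W ^t* *m A *m W) k k = (row k (W ^t* *m A) *m col k W) 0 0.
  rewrite [LHS]mxE [RHS]mxE; apply: eq_bigr => j _.
  by rewrite [row _ _ _ _]mxE [col _ _ _ _]mxE.
by rewrite row_mul.
Qed.

End Psd.

(** * Exchanging the tensor factors *)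

Section Swap.
Variables (R : realType) (n : nat).
Local Notation C := R[i].
Local Notation N := (2 ^ (n + n))%N.
Implicit Types (X Y : 'M[C]_N) (A B : 'M[C]_(2 ^ n)).

Definition pair_index (ij : 'I_(2 ^ n) * 'I_(2 ^ n)) : 'I_N :=
  cast_ord (esym (expnD 2 n n)) (mxtens_index ij).

Definition unpair_index (k : 'I_N) : 'I_(2 ^ n) * 'I_(2 ^ n) :=
  mxtens_unindex (cast_ord (expnD 2 n n) k).

Lemma pair_indexK : cancel pair_index unpair_index.
Proof. by move=> ij; rewrite /unpair_index cast_ordKV mxtens_indexK. Qed.

Lemma unpair_indexK : cancel unpair_index pair_index.
Proof. by move=> k; rewrite /pair_index mxtens_unindexK cast_ordK. Qed.

Definition swap_index (k : 'I_N) : 'I_N :=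
  pair_index ((unpair_index k).2, (unpair_index k).1).

Lemma swap_indexK : involutive swap_index.
Proof.
move=> k; rewrite -[RHS]unpair_indexK /swap_index pair_indexK.
by case: (unpair_index k).
Qed.

Lemma qtensE A B k l : qtens A B k l =
  A (unpair_index k).1 (unpair_index l).1 * B (unpair_index k).2 (unpair_index l).2.
Proof. by rewrite /qtens castmxE !esymK mxE. Qed.

Lemma qtens_mul A B A' B' :
  qtens A B *m qtens A' B' = qtens (A *m A') (B *m B').
Proof.
rewrite /qtens -tensmx_mul.
by move: (esym (expnD 2 n n)) => e; case: _ / e.
Qed.

Lemma qtens_adj A B : (qtens A B) ^t* = qtens (A ^t*) (B ^t*).
Proof. by apply/matrixP => k l; rewrite !mxE !qtensE !mxE rmorphM. Qed.

Lemma psd_tr_qtens X A B : psd X -> psd A -> psd B ->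
  0 <= \tr (X *m qtens A B).
Proof.
move=> pX /psd_factor[K ->] /psd_factor[L ->].
by rewrite -qtens_mul -qtens_adj psd_trace_ge0.
Qed.

Definition swapmx X : 'M[C]_N := \matrix_(i, j) X (swap_index i) (swap_index j).

Lemma swapmxK : involutive swapmx.
Proof. by move=> X; apply/matrixP => i j; rewrite !mxE !swap_indexK. Qed.

Lemma swapmxB X Y : swapmx (X - Y) = swapmx X - swapmx Y.
Proof. by apply/matrixP => i j; rewrite !mxE. Qed.

Lemma swapmx_mul X Y : swapmx (X *m Y) = swapmx X *m swapmx Y.
Proof.
apply/matrixP => i j; rewrite !mxE (reindex_inj (inv_inj swap_indexK)) /=.
by apply: eq_bigr => k _; rewrite !mxE.
Qed.

Lemma tr_swapmx X : \tr (swapmx X) = \tr X.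
Proof.
rewrite /mxtrace [RHS](reindex_inj (inv_inj swap_indexK)) /=.
by apply: eq_bigr => k _; rewrite mxE.
Qed.

Lemma swapmx_qtens A B : swapmx (qtens A B) = qtens B A.
Proof.
apply/matrixP => i j; rewrite mxE !qtensE /swap_index !pair_indexK /=.
by rewrite mulrC.
Qed.

(** The form of [swapmx X] at [v] is the form of [X] at the permuted vector. *)
Lemma psd_swapmx X : psd X -> psd (swapmx X).
Proof.
move=> pX v; have := pX (\col_k v (swap_index k) 0).
suff -> : (v ^t* *m swapmx X *m v) 0 0 =
  ((\col_k v (swap_index k) 0) ^t* *m X *m (\col_k v (swap_index k) 0)) 0 0.
  by [].
rewrite !mxE [RHS](reindex_inj (inv_inj swap_indexK)) /=.
apply: eq_bigr => k _; rewrite !mxE swap_indexK; congr (_ * _).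
rewrite [RHS](reindex_inj (inv_inj swap_indexK)) /=.
by apply: eq_bigr => j _; rewrite !mxE swap_indexK.
Qed.

Lemma semi_density_swapmx X : semi_density X -> semi_density (swapmx X).
Proof. by move=> [pX tX]; split; [exact: psd_swapmx | rewrite tr_swapmx]. Qed.

Lemma size_swap_halves s : ~~ odd (size s) -> size (swap_halves s) = size s.
Proof.
move=> os; have h : ((size s)./2 <= size s)%N by lia.
by rewrite size_cat size_drop size_takel // subKn // addnn even_halfK.
Qed.

Lemma bits_nat_cat s t : bits_nat (s ++ t) = (bits_nat s * 2 ^ size t + bits_nat t)%N.
Proof.
elim/last_ind: t => [|t b IH]; first by rewrite cats0 expn0 muln1 addn0.
rewrite -rcons_cat /bits_nat !foldl_rcons -!/(bits_nat _) IH size_rcons expnS.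
by rewrite -!mul2n mulnDr mulnCA addnA.
Qed.

Lemma bits_nat_lt s : (bits_nat s < 2 ^ size s)%N.
Proof.
elim/last_ind: s => // s b; rewrite /bits_nat foldl_rcons size_rcons expnS.
by case: b; lia.
Qed.

(** The two halves of [s] are the digits of its value in base 2^n, and the digits of an index in
    this base are its two tensor components; uniqueness of digits finishes the comparison. *)
Lemma bits_nat_swap s (i : 'I_N) : size s = (n + n)%N ->
  (bits_nat (swap_halves s) == i) = (bits_nat s == swap_index i).
Proof.
move=> hs; have h2 : (size s)./2 = n by rewrite hs addnn doubleK.
rewrite /swap_halves h2 hs addnK.
rewrite -{3}(cat_take_drop n s).
have st : size (take n s) = n by rewrite size_takel // hs leq_addr.
have sd : size (drop n s) = n by rewrite size_drop hs addnK.
rewrite !bits_nat_cat st sd.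
have dl := bits_nat_lt (drop n s); have tl := bits_nat_lt (take n s).
rewrite st sd in dl tl.
rewrite -{1}(unpair_indexK i) /= /swap_index /pair_index /=.
rewrite !eq_addl_mul //; first by rewrite !xpair_eqE andbC.
  by rewrite ltn_divLR ?expn_gt0 // -expnD.
by rewrite ltn_mod expn_gt0.
Qed.

Lemma terms_mx_swap l : terms_on (n + n) l ->
  terms_mx R (n + n) (map swap_term l) = swapmx (terms_mx R (n + n) l).
Proof.
move=> /allP hl; apply/matrixP => i j; rewrite !mxE big_map.
rewrite big_seq_cond [RHS]big_seq_cond; apply: eq_bigl => t.
case E: (t \in l) => //=; have /andP[/eqP h1 /eqP h2] := hl _ E.
by rewrite !bits_nat_swap.
Qed.

Lemma terms_on_swap l : terms_on (n + n) l -> terms_on (n + n) (map swap_term l).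
Proof.
rewrite /terms_on all_map; apply: sub_all => t /andP[/eqP h1 /eqP h2] /=.
by rewrite !size_swap_halves ?h1 ?h2 ?eqxx // addnn odd_double.
Qed.

Lemma lower_computes_swap U t q X :
    (forall ls, emits U [::] q (flatten (map mx_code ls)) ->
       emits U [::] (t ++ q)
         (flatten [seq mx_code (map swap_term l) | l <- ls])) ->
  lower_computes U q X -> lower_computes U (t ++ q) (swapmx X).
Proof.
move=> ht [pX [L [hL mL cL eL]]]; split; first exact: psd_swapmx.
exists (fun k => map swap_term (L k)) => E.
have EE k : E k = swapmx (terms_mx R (n + n) (L k)).
  by rewrite /E terms_mx_swap //; case: (hL k).
split.
- move=> k; rewrite EE; have [h1 h2] := hL k.
  by split; [exact: terms_on_swap | exact: semi_density_swapmx].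
- by move=> k; rewrite !EE /loewner_le -swapmxB; apply: psd_swapmx (mL k).
- move=> i j; have [hr hi] := cL (swap_index i) (swap_index j).
  have -> : (fun k => complex.Re (E k i j)) =
    (fun k => complex.Re (terms_mx R (n + n) (L k) (swap_index i) (swap_index j))).
    by apply/funext => k; rewrite EE mxE.
  have -> : (fun k => complex.Im (E k i j)) =
    (fun k => complex.Im (terms_mx R (n + n) (L k) (swap_index i) (swap_index j))).
    by apply/funext => k; rewrite EE mxE.
  by rewrite mxE.
- move=> k; have := ht [seq L i | i <- iota 0 k].
  by rewrite -!map_comp; apply; exact: eL.
Qed.

(** The bounds for semi-density matrices pass to the limit. Being uniform, they make the weighted
    sums over tests absolutely convergent. *)
Lemma lower_computable_entries U X i j : lower_computable U X ->
  `|complex.Re (X i j)| <= 1 /\ `|complex.Im (X i j)| <= 1.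
Proof.
move=> [q [_ [L [hL _ cL _]]]]; have [cr ci] := cL i j.
have hE k := semi_density_entries i j (hL k).2.
have lim1 (u : nat -> R) l : u @ \oo --> l -> (forall k, `|u k| <= 1) -> `|l| <= 1.
  move=> /cvg_norm cu hu; rewrite -(cvg_lim _ cu) //.
  by apply: limr_le; [apply: cvgP cu | near=> k; apply: hu].
by split; [apply: lim1 cr _ | apply: lim1 ci _] => k; case: (hE k).
Unshelve. all: by end_near.
Qed.

End Swap.

(** * The universal test *)

Section UniversalTest.
Variables (R : realType) (U : machine) (n : nat).
Local Notation N := (2 ^ (n + n))%N.
Implicit Types (X Y : 'M[R[i]]_N) (C : 'M[R[i]]_(2 ^ n)).

Definition weight X : R := fine (lprob U X (nat_bits n)).

Lemma weight_ge0 X : 0 <= weight X.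
Proof. by rewrite fine_ge0 // lprob_ge0. Qed.

Lemma weightE X : (weight X)%:E = lprob U X (nat_bits n).
Proof. by rewrite fineK // lprob_fin_num. Qed.

Lemma rsummable_weight (D : set 'M[R[i]]_N) f (b : R) : 0 <= b ->
  (forall X, D X -> `|f X| <= b * weight X) -> rsummable D f.
Proof.
move=> b0 hf; rewrite /rsummable /summable.
apply: (@le_lt_trans _ _ (b%:E * \esum_(X in D) lprob U X (nat_bits n))%E).
  rewrite -esumZ //; last by move=> X _; exact: lprob_ge0.
  by apply: le_esum => X DX /=; rewrite -weightE -EFinM lee_fin hf.
apply: lte_mul_pinfty; rewrite ?lee_fin //.
apply: le_lt_trans (ltry 1); exact: esum_lprob_le1.
Qed.

(** The universal test is defined entrywise, so its trace against [Y] is a finite combination of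
    real sums over tests; linearity of [rsum] gathers them into one sum of traces. *)
Lemma Re_tr_universal_test C C' Y :
  rsummable (tests U C C') (fun X => weight X * complex.Re (\tr (X *m Y))) /\
  complex.Re (\tr (universal_test U C C' *m Y)) =
  rsum (tests U C C') (fun X => weight X * complex.Re (\tr (X *m Y))).
Proof.
set D := tests U C C'.
have sr i j : rsummable D (fun X => weight X * complex.Re (X i j)).
  apply: (rsummable_weight (b := 1)) => // X [hX _].
  have [h _] := lower_computable_entries i j hX.
  by rewrite normrM (ger0_norm (weight_ge0 X)) mulrC ler_wpM2r ?weight_ge0.
have si i j : rsummable D (fun X => weight X * complex.Im (X i j)).
  apply: (rsummable_weight (b := 1)) => // X [hX _].
  have [_ h] := lower_computable_entries i j hX.
  by rewrite normrM (ger0_norm (weight_ge0 X)) mulrC ler_wpM2r ?weight_ge0.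
pose G i j X := complex.Re (Y j i) * (weight X * complex.Re (X i j)) +
                (- complex.Im (Y j i)) * (weight X * complex.Im (X i j)).
have sG i j : rsummable D (G i j).
  by apply: rsummableD; apply: rsummableZ.
have GE : (fun X => weight X * complex.Re (\tr (X *m Y))) =
          (fun X => \sum_i \sum_j G i j X).
  apply/funext => X; rewrite cRe_sum mulr_sumr; apply: eq_bigr => i _.
  rewrite mxE cRe_sum mulr_sumr; apply: eq_bigr => j _.
  by rewrite cReM /G; ring.
have sGi i := rsum_sum (index_enum 'I_N) (sG i).
have sGG := rsum_sum (index_enum 'I_N) (fun i => (sGi i).1).
rewrite GE; split; first exact: sGG.1.
rewrite sGG.2 cRe_sum; apply: eq_bigr => i _.
rewrite (sGi i).2 mxE cRe_sum; apply: eq_bigr => j _.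
rewrite cReM rsumD ?rsumZ //; try exact: rsummableZ.
rewrite /universal_test /mxsum !mxE /= -/D.
have -> : (fun X => complex.Re ((Complex (fine (lprob U X (nat_bits n))) 0 *: X) i j)) =
          (fun X => weight X * complex.Re (X i j)).
  by apply/funext => X; rewrite mxE cReM mul0r subr0.
have -> : (fun X => complex.Im ((Complex (fine (lprob U X (nat_bits n))) 0 *: X) i j)) =
          (fun X => weight X * complex.Im (X i j)).
  by apply/funext => X; rewrite mxE; case: (X i j) => x y /=; rewrite mul0r addr0.
by rewrite mulNr mulrC [X in _ - X]mulrC.
Qed.

(** The trace condition survives the exchange because both of its factors are the same matrix
    [C]. *)
Lemma tests_swap C t X :
    (forall q X, lower_computes U q X -> lower_computes U (t ++ q) (swapmx X)) ->
  tests U C C X -> tests U C C (swapmx X).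
Proof.
move=> ht [[q hq] [A [B [XE hAB]]]]; split; first by exists (t ++ q); apply: ht.
exists B, A; rewrite XE swapmx_qtens; split=> //.
by rewrite -tr_swapmx swapmx_mul !swapmx_qtens.
Qed.

Lemma Re_tr_qtens_ge0 X A B : lower_computable U X -> psd A -> psd B ->
  0 <= complex.Re (\tr (X *m qtens A B)).
Proof.
move=> [q [pX _]] pA pB.
by have := psd_tr_qtens pX pA pB; rewrite lecE => /andP[].
Qed.

Lemma universal_test_swap C t c sigma rho : 0 <= c ->
    (forall q X, lower_computes U q X -> lower_computes U (t ++ q) (swapmx X)) ->
    (forall q, (uprob R U q (nat_bits n) <= c%:E * uprob R U (t ++ q) (nat_bits n))%E) ->
    psd sigma -> psd rho ->
  complex.Re (\tr (universal_test U C C *m qtens sigma rho)) <=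
  c * complex.Re (\tr (universal_test U C C *m qtens rho sigma)).
Proof.
move=> c0 ht hq ps pr.
have [s1 ->] := Re_tr_universal_test C C (qtens sigma rho).
have [s2 ->] := Re_tr_universal_test C C (qtens rho sigma).
have p1 X : tests U C C X ->
    0 <= weight X * complex.Re (\tr (X *m qtens sigma rho)).
  by move=> [hX _]; rewrite mulr_ge0 ?weight_ge0 ?(Re_tr_qtens_ge0 hX).
have p2 X : tests U C C X ->
    0 <= weight X * complex.Re (\tr (X *m qtens rho sigma)).
  by move=> [hX _]; rewrite mulr_ge0 ?weight_ge0 ?(Re_tr_qtens_ge0 hX).
(* As all terms are nonnegative, both sides become extended sums, which can be compared along the
   injection [swapmx]. *)
rewrite !rsum_ge0E // -lee_fin EFinM !fineK ?rsummable_fin_num //.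
apply: (@esum_le_scaled _ _ _ _ _ (@swapmx R n)) => //.
- by move=> X X' _ _ /(inv_inj (@swapmxK R n)).
- by move=> X; apply: tests_swap ht.
move=> X hX; rewrite -EFinM lee_fin mulrA.
have -> : \tr (swapmx X *m qtens rho sigma) = \tr (X *m qtens sigma rho).
  by rewrite -[RHS]tr_swapmx swapmx_mul swapmx_qtens.
apply: ler_wpM2r; first exact: Re_tr_qtens_ge0 hX.1 ps pr.
rewrite -lee_fin EFinM !weightE.
by apply: (lprob_translate (t := t)) => // q; apply: ht.
Qed.

End UniversalTest.

(** * Logarithms and conclusion *)

Lemma log2e_le (R : realType) (a b : R) k : a <= 2 ^+ k * b ->
  (log2e a%:E <= log2e b%:E + k%:R%:E)%E.
Proof.
move=> hab; have l2 : 0 < ln 2 :> R by rewrite ln_gt0 // ltr1n.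
(* For [a <= 0] the left side is -oo by the convention of [lne]; for [a > 0] the hypothesis forces
   [b > 0]. *)
rewrite /log2e; have [a0|a0] := leP a 0.
  by rewrite le0_lneNy ?lee_fin // gt0_mulNye ?leNye // lte_fin invr_gt0.
have b0 : 0 < b.
  rewrite ltNge; apply/negP => b0; have := lt_le_trans a0 hab.
  by rewrite ltNge mulr_ge0_le0.
rewrite !lne_EFin // -!EFinM -EFinD lee_fin.
have -> : k%:R = ln (2 ^+ k) * (ln 2)^-1 :> R.
  by rewrite lnXn // -[ln 2 *+ k]mulr_natl mulfK // gt_eqF.
rewrite -mulrDl ler_pM2r ?invr_gt0 // addrC -lnM ?posrE ?exprn_gt0 //.
by rewrite ler_ln ?posrE ?mulr_gt0 ?exprn_gt0.
Qed.

Theorem theorem4 (R : realType) (U : machine) (hU : universal U) :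
  exists c : R, forall (n : nat) (sigma rho : 'M[R[i]]_(2 ^ n)),
    semi_density sigma -> semi_density rho ->
    (mutual_info U sigma rho <= mutual_info U rho sigma + c%:E)%E /\
    (mutual_info U rho sigma <= mutual_info U sigma rho + c%:E)%E.
Proof.
(* The word [t] is used through the [emits] clause of universality, the word [u] through its
   [computes] clause. *)
have [T hT] := swap_machine U; have [t ht] := hU T.
have [T' hT'] := print_word U t; have [u hu] := hU T'.
(* Both words are obtained before [n] is introduced, so the constant is uniform in the dimension and
   the states. *)
exists (size u)%:R => n.
suff main (sigma rho : 'M[R[i]]_(2 ^ n)) : psd sigma -> psd rho ->
    (mutual_info U sigma rho <= mutual_info U rho sigma + (size u)%:R%:E)%E.
  by move=> sigma rho [ps _] [pr _]; split; apply: main.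
move=> ps pr; apply: log2e_le.
apply: (@universal_test_swap _ _ _ _ t) => //.
- move=> q X; apply: lower_computes_swap => ls /hT.
  exact: ((ht [::] q).2 _).1.
- move=> q; apply: (@uprob_print R U t T') => // y p x.
  exact: ((hu y p).1 x).1.
Qed.
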